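(* There is no quasi-symmetric $(56,12,9)$ design (with block intersection numbers $x=0$, $y=3$) that admits an automorphism group isomorphic to $Frob_{21}$, the Frobenius group of order $21$.
   Context: A block design with parameters $(v,k,\lambda)$ consists of a set of $v$ points and a family of $k$-element subsets of the point set, called blocks, such that every pair of distinct points is contained in exactly $\lambda$ blocks. A design is quasi-symmetric with intersection numbers $x<y$ if $|B_1\cap B_2|\in\{x,y\}$ for any two blocks $B_1,B_2$ and both values occur. A quasi-symmetric $(56,12,9)$ design means one with intersection numbers $x=0$, $y=3$; it would have $210$ blocks and $45$ blocks through each point. An automorphism of a design is a permutation of its points mapping blocks onto blocks, and a design admits an automorphism group isomorphic to $G$ if its group of all automorphisms has a subgroup isomorphic to $G$. $Frob_{21}\cong \mathbb{Z}_7\rtimes\mathbb{Z}_3$ is the nonabelian group of order $21$. *)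

(* Defs.v *)
From mathcomp Require Import all_boot all_order all_algebra all_fingroup all_solvable.
Set Implicit Arguments.
Unset Strict Implicit.
Unset Printing Implicit Defensive.
Local Open Scope group_scope.

(* A design is a family [B : I -> {set T}], so that repeated blocks (equal sets
   at different indices) are allowed. *)
Definition is_design (T I : finType) (B : I -> {set T}) (v k lambda : nat) : Prop :=
  [/\ #|T| = v,
      forall i : I, #|B i| = k &
      forall p q : T, p != q ->
        #|[set i : I | (p \in B i) && (q \in B i)]| = lambda].

Definition quasi_symmetric (T I : finType) (B : I -> {set T}) (x y : nat) : Prop :=
  [/\ (x < y)%N,
      forall i j : I, i != j -> #|B i :&: B j| = x \/ #|B i :&: B j| = y,
      exists i j : I, i != j /\ #|B i :&: B j| = x &
      exists i j : I, i != j /\ #|B i :&: B j| = y].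

(* [s] permutes the indices, so that images of blocks are counted with
   multiplicity. *)
Definition design_aut (T I : finType) (B : I -> {set T}) : {set {perm T}} :=
  [set g : {perm T} | [exists s : {perm I}, [forall i, g @: B i == B (s i)]]].

Lemma design_autP (T I : finType) (B : I -> {set T}) (g : {perm T}) :
  reflect (exists s : {perm I}, forall i, g @: B i = B (s i))
          (g \in design_aut B).
Proof.
rewrite inE; apply: (iffP existsP) => -[s Hs]; exists s.
  by move=> i; apply/eqP/(forallP Hs).
by apply/forallP=> i; apply/eqP.
Qed.

Lemma design_aut_group_set (T I : finType) (B : I -> {set T}) :
  group_set (design_aut B).
Proof.
apply/group_setP; split=> [|g h /design_autP[s Hs] /design_autP[t Ht]].
  apply/design_autP; exists 1 => i; rewrite perm1 -[RHS]imset_id.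
  by apply: eq_imset => p; rewrite perm1.
apply/design_autP; exists (s * t) => i; rewrite permM -Ht -Hs -imset_comp.
by apply: eq_imset => p; rewrite permM.
Qed.

Canonical design_aut_group (T I : finType) (B : I -> {set T}) :=
  Group (design_aut_group_set B).

Definition admits_aut_group (T I : finType) (B : I -> {set T})
    (gT : finGroupType) (G : {group gT}) : Prop :=
  exists2 H : {group {perm T}}, H \subset design_aut B & H \isog G.

(* The group Z_7 : Z_3 realized as the affine maps z |-> u z + b of the field
   with 7 elements whose linear part satisfies u ^ 3 = 1. *)
Definition affine_fun (u : {unit 'F_7}) (b z : 'F_7) : 'F_7 :=
  (val u * z + b)%R.

Lemma affine_fun_inj (u : {unit 'F_7}) (b : 'F_7) : injective (affine_fun u b).
Proof. by move=> z t /GRing.addIr /(GRing.mulrI (valP u)). Qed.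

Definition affine (u : {unit 'F_7}) (b : 'F_7) : {perm 'F_7} :=
  perm (@affine_fun_inj u b).

Definition Frob21 : {set {perm 'F_7}} :=
  [set affine w.1 w.2 | w : {unit 'F_7} * 'F_7 & w.1 ^+ 3 == 1].

Lemma Frob21_group_set : group_set Frob21.
Proof.
apply/group_setP; split=> [|_ _ /imsetP[[u b] Hu ->] /imsetP[[t c] Ht ->]].
  apply/imsetP; exists (1, 0%R); first by rewrite inE expg1n.
  by apply/permP=> z; rewrite perm1 permE /affine_fun /= GRing.mul1r GRing.addr0.
rewrite !inE /= in Hu Ht.
apply/imsetP; exists (t * u, (val t * b + c)%R).
  rewrite inE /= expgMn; last by apply: val_inj; rewrite /= GRing.mulrC.
  by rewrite (eqP Hu) (eqP Ht) mulg1.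
apply/permP=> z; rewrite permM !permE /affine_fun /=.
by rewrite GRing.mulrDr GRing.mulrA GRing.addrA.
Qed.

Canonical Frob21_group := Group Frob21_group_set.

Lemma affine_inj : injective (fun w : {unit 'F_7} * 'F_7 => affine w.1 w.2).
Proof.
move=> [u b] [t c] /= /permP E.
have := E 0%R; rewrite !permE /affine_fun !GRing.mulr0 !GRing.add0r => ->.
have := E 1%R; rewrite !permE /affine_fun !GRing.mulr1.
have := E 0%R; rewrite !permE /affine_fun !GRing.mulr0 !GRing.add0r => ->.
by move/GRing.addIr/val_inj=> ->.
Qed.

Lemma Frob21_nonabelian : ~~ abelian Frob21.
Proof.
have U2 : (2%:R : 'F_7)%R \is a GRing.unit by [].
pose u : {unit 'F_7} := FinRing.unit 'F_7 U2.
have in1 : affine u 0%R \in Frob21.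
  by apply/imsetP; exists (u, 0%R); rewrite // inE; apply/eqP; apply: val_inj; apply: val_inj.
have in2 : affine 1 1%R \in Frob21.
  by apply/imsetP; exists (1, 1%R); rewrite // inE expg1n.
apply/negP=> /centsP /(_ _ in1 _ in2) /permP /(_ 0%R).
by rewrite !permM !permE.
Qed.

Lemma card_Frob21 : #|Frob21| = 21.
Proof.
pose U := [set u : {unit 'F_7} | u ^+ 3 == 1].
pose S := [:: 1; 2%:R; 4%:R : 'F_7]%R.
have cardU : #|U| = 3.
  rewrite -(card_imset _ val_inj).
  have -> : [set val u | u in U] = [set z in S].
    apply/setP=> z; rewrite inE; apply/imsetP/idP => [[u Hu ->]|Hz].
      move: Hu; rewrite inE -val_eqE FinRing.val_unitX FinRing.val_unit1.
      by case: (val u) => -[|[|[|[|[|[|[|m]]]]]]].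
    have Uz : z \is a GRing.unit by move: Hz; rewrite !inE => /or3P[]/eqP->.
    exists (FinRing.unit 'F_7 Uz) => //.
    rewrite inE -val_eqE FinRing.val_unitX FinRing.val_unit1 /=.
    by move: Hz; rewrite !inE => /or3P[]/eqP->.
  by rewrite cardsE; apply/eqP; rewrite (card_uniqP _).
have -> : Frob21 = (fun w => affine w.1 w.2) @: setX U [set: 'F_7].
  by apply/setP=> g; apply/imsetP/imsetP=> -[[u b]]; rewrite !inE ?andbT /= => Hu ->;
    exists (u, b); rewrite // !inE ?andbT.
by rewrite (card_imset _ affine_inj) cardsX cardU cardsT card_Fp.
Qed.

(* Main.v *)
Require Import Defs.
From mathcomp Require Import all_boot all_order all_algebra all_fingroup all_solvable.
From mathcomp Require Import zify.
Set Implicit Arguments.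
Unset Strict Implicit.
Unset Printing Implicit Defensive.

(** Let sigma and phi be the automorphisms of orders 7 and 3 that generate the
    group, with phi sigma = sigma^2 phi.  The idea is to reduce the design to its
    orbit matrix under sigma, where only a few kinds of blocks survive, and then
    to play two such blocks and their images against each other.

    Fixed points.  Two blocks on a common point meet in 3 points, and standard
    counting shows that any three points lie on one or two blocks
    ([triple_cover]).  This bounds, in both directions, the number of fixed
    points of an automorphism in terms of its fixed blocks ([fixed_bounds],
    [fixed_coverage]).  The bounds show that sigma fixes no point
    ([order7_fixed_points]), so that the points form 8 orbits of size 7, called
    rows, and that phi fixes exactly two points p and q ([order3_fixed_points]).
    The rows are then those of p and q and two cycles of three rows each under
    phi.  Inside a row, points are residues modulo 7, sigma adds 1 and phi
    doubles.

    Row weights.  The vector (x,y;u;w) counts the points of a block in the rows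
    of p and q and in the two cycles of rows.  The inner product of two such
    vectors is the total intersection of one block with the 7 translates of the
    other, hence it is a multiple of 3 and at most 21, except for blocks in the
    same sigma-orbit.  This leaves few vectors ([feasible_vectors]).  Exactly 21
    blocks have x = y = 3 and exactly 21 have x = y = 0 ([card_33_00]); as a
    vector is shared by at most 7 blocks, both kinds contain a block whose vector
    is not invariant under phi.  Up to symmetry there is a block B of type
    (3,3;3,0,0;1,1,1) ([exists_normal_33]) and a block D of one of the types
    (0,0;0,3,3;2,2,2), (0,0;1,1,4;2,2,2), (0,0;2,2,2;0,3,3), (0,0;2,2,2;4,1,1)
    ([exists_normal_00]).

    Contradiction.  B has three points in one row, forming a set U of residues,
    and single points w0, w1, w2 in the rows of the other cycle.  All translates
    of B meet B in 3 points, which forces U to be an arithmetic progression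
    ([U_not_fano]).  B meets each translate of D in 0 or 3 points: so the overlap
    of U with translates of a row of D, plus the indicators of the sets w_i - D_i
    with D_i the corresponding rows of D, takes the values 0 and 3 only
    ([overlaps_with_B]).  For three of the types of D this contradicts the fact
    that D meets its own translates in 3 points.  For the type (0,0;2,2,2;0,3,3)
    it fixes, up to a sign, the difference of the sums of the residues in the two
    triples of D; adding these relations for D, phi D and phi^2 D eliminates all
    unknown residues and leaves an odd multiple of the step of the progression
    that would have to vanish modulo 7 ([signs_odd]). *)

(** * Incidences and fixed points *)

Lemma sum_incidence (T : finType) (A : {set {set T}}) (S : {set T}) :
  \sum_(p in S) #|[set C in A | p \in C]| = \sum_(C in A) #|S :&: C|.
Proof.
have -> : \sum_(p in S) #|[set C in A | p \in C]|
        = \sum_(p in S) \sum_(C in A) (p \in C : nat).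
  apply: eq_bigr => p _; rewrite -sum1_card big_mkcond [RHS]big_mkcond /=.
  by apply: eq_bigr => C _; rewrite inE; case: (C \in A); case: (p \in C).
rewrite exchange_big; apply: eq_bigr => C _ /=.
rewrite -sum1_card big_mkcond [RHS]big_mkcond /=.
by apply: eq_bigr => p _; rewrite inE; case: (p \in S); case: (p \in C).
Qed.

(** The points moved by [g] fall into orbits of length [r]. *)
Lemma card_fix_mod (gT : finGroupType) (sT : finType)
    (to : {action gT &-> sT}) (S : {set sT}) (g : gT) r :
  prime r -> (g ^+ r = 1)%g -> (forall x, x \in S -> to x g \in S) ->
  #|[set x in S | to x g == x]| = #|S| %[mod r].
Proof.
move=> pr gr gS; have rg : (r.-group <[g]>)%g.
  by rewrite /pgroup -orderE (pnat_dvd _ (pnat_id pr)) // order_dvdn gr eqxx.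
have gA : [acts <[g]>%g, on S | to].
  by rewrite cycle_subG !inE; apply/subsetP=> x xS; rewrite inE gS.
rewrite (pgroup_fix_mod rg gA); congr (_ %% _); apply: eq_card => x.
by rewrite inE in_setI afix_cycle; congr andb; apply/eqP/afix1P.
Qed.

Section FixedPoints.

Variables (T : finType) (g : {perm T}) (r : nat).
Hypothesis r_pr : prime r.
Hypothesis gr1 : (g ^+ r = 1)%g.

Definition fixed_points := [set x | g x == x].

Lemma card_fixed_points_mod (S : {set T}) :
  g @: S = S -> #|S :&: fixed_points| = #|S| %[mod r].
Proof.
move=> gS; rewrite -(@card_fix_mod _ _ 'P S g r) //.
  by congr (_ %% _); apply: eq_card => x; rewrite !inE.
by move=> x xS; rewrite -gS; apply/imsetP; exists x.
Qed.

Lemma card_fixed_sets_mod (A : {set {set T}}) :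
  (forall C, C \in A -> g @: C \in A) ->
  #|[set C in A | g @: C == C]| = #|A| %[mod r].
Proof.
by move=> gA; apply: (@card_fix_mod _ _ ('P^*)%act A g r).
Qed.

End FixedPoints.

Lemma uniq_map_inj_in (A B : eqType) (f : A -> B) s :
  uniq [seq f x | x <- s] -> {in s &, injective f}.
Proof.
elim: s => //= a s IHs /andP[fa us] x y.
rewrite !inE => /predU1P[-> | xs] /predU1P[-> | ys] //; last exact: IHs.
  by move=> E; rewrite E map_f in fa.
by move=> E; rewrite -E map_f in fa.
Qed.

(** * Subsets of the integers modulo 7 *)

(** Subsets of the integers modulo 7 are lists of 7 booleans, so that statements
    about all of them can be decided by evaluation.  Modulo 7, [6 * b] is [- b]
    and [4 * z] is [z / 2]: the three operations below send a set M to M + b, to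
    2 M and to w - M. *)
Definition bit (m : seq bool) z := nth false m (z %% 7).
Definition shift_mask b m := [seq bit m (z + 6 * b) | z <- iota 0 7].
Definition double_mask m := [seq bit m (4 * z) | z <- iota 0 7].
Definition reflect_mask w m := [seq bit m (w + 6 * b) | b <- iota 0 7].
Definition overlap m n := count (fun z => nth false m z && nth false n z) (iota 0 7).
Definition weight (m : seq bool) := count id m.
Definition autocorr m b := overlap m (shift_mask b m).
Definition overlaps m n := [seq overlap m (shift_mask b n) | b <- iota 0 7].
Definition mask_sum (m : seq bool) := sumn [seq z <- iota 0 7 | nth false m z].
Definition indicator (m : seq bool) : seq nat := [seq nat_of_bool x | x <- m].
Definition add_seq (u v : seq nat) := [seq p.1 + p.2 | p <- zip u v].
(** An arithmetic progression of three terms with step d has autocorrelation 2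
    at d. *)
Definition ap_step m := if autocorr m 1 == 2 then 1 else if autocorr m 2 == 2 then 2 else 3.

Fixpoint bitseqs n : seq (seq bool) :=
  if n is n'.+1 then
    [seq false :: m | m <- bitseqs n'] ++ [seq true :: m | m <- bitseqs n']
  else [:: [::]].

Definition masks k := [seq m <- bitseqs 7 | weight m == k].

Arguments masks : simpl never.

Lemma mem_bitseqs m : m \in bitseqs (size m).
Proof.
elim: m => [|[] m IHm] //=; rewrite mem_cat; apply/orP; [right|left];
  by apply: map_f.
Qed.

Lemma mem_masks m k : size m = 7 -> weight m = k -> m \in masks k.
Proof. by move=> sm wm; rewrite mem_filter wm eqxx -sm mem_bitseqs. Qed.

(** A value is completable if it becomes 0 or 3 by adding 0 or 1. *)
Definition completable v := match v with 0 | 2 | 3 => true | _ => false end.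
Definition autocorrs m := [:: autocorr m 1; autocorr m 2; autocorr m 3].
(** For 3-subsets, this says that the set is a line of the Fano plane up to a
    translation or a reflection; the other 3-subsets are arithmetic progressions
    and have autocorrelations (2,1,0) in some order. *)
Definition fano m := autocorrs m == [:: 1; 1; 1].

Lemma nth_add_seq u v k : size u = size v ->
  nth 0 (add_seq u v) k = nth 0 u k + nth 0 v k.
Proof.
by elim: u v k => [|a u IHu] [|b v] [|k] //= [/IHu]; apply.
Qed.

Lemma size_add_seq u v : size u = size v -> size (add_seq u v) = size u.
Proof. by move=> uv; rewrite size_map size_zip uv minnn. Qed.

(** When several sets have indicators adding up to values 0 and 3 only, the last
    set is determined by the others: it consists of the positions where the
    others add up to 2.  Thus the evaluations below need one loop fewer. *)
Lemma complete_to_0_3 (c : seq nat) (Y : seq bool) : size c = 7 -> size Y = 7 ->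
  (forall k, k < 7 -> nth 0 c k + nth false Y k \in [:: 0; 3]) ->
  all completable c /\ Y = [seq v == 2 | v <- c].
Proof.
elim: 7 c Y => [|n IHn] [|v c] [|y Y] //= [sc] [sY] vy.
have [|-> {1}->] := IHn c Y sc sY; first by move=> k; apply: (vy k.+1).
move: (vy 0 isT) => /=; rewrite andbT.
by case: y {vy sY}; case: v => [|[|[|[|v]]]].
Qed.

(** The hypothesis forces both triples to be translates of {1,2,4} or of its
    negative.  Doubling sends such a set to a translate of itself; at the
    translation where the first triple coincides with its double the overlap is
    3, and the second triple contributes at least 1. *)
Lemma fano_pair_overlap :
  all (fun A1 => all (fun A2 =>
  (add_seq (autocorrs A1) (autocorrs A2) == [:: 2; 2; 2]) ==>
  ~~ all (fun v => v <= 3)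
    (add_seq (overlaps A1 (double_mask A1)) (overlaps A2 (double_mask A2))))
  (masks 3)) (masks 3).
Proof. by vm_compute. Qed.

(** The difference inside the pair uses up the total 3, so both triples would
    avoid that difference, and the two others would each occur 3 times in total;
    but triples that avoid a given difference all have the same
    autocorrelations, whose doubles are even. *)
Lemma equal_pairs_autocorr :
  let acs3 := undup [seq autocorrs m | m <- masks 3] in
  all (fun v1 => all (fun v2 => all (fun x =>
    add_seq (add_seq v1 v2) (add_seq x (add_seq x x)) != [:: 3; 3; 3])
  (undup [seq autocorrs m | m <- masks 2])) acs3) acs3.
Proof. by vm_compute. Qed.

(** Three pairs that cover each point of a triple twice are the three pairs in
    this triple. *)
Lemma double_cover_autocorr :
  all (fun X0 => all (fun X1 => let c1 := add_seq (indicator X0) (indicator X1) in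
    all (fun X2 => let c := add_seq c1 (indicator X2) in
      if ~~ all completable c then true else
      let T := [seq v == 2 | v <- c] in
      (weight T == 3) ==>
      (add_seq (add_seq (autocorrs X0) (autocorrs X1)) (autocorrs X2) == autocorrs T))
  (masks 2)) (masks 2)) (masks 2).
Proof. by vm_compute. Qed.

(** The overlaps with the translates of one point form a reflected copy of [U]. *)
Lemma point_in_triple :
  all (fun U => all (fun s =>
  let T := [seq v == 1 | v <- overlaps U s] in
  [&& indicator T == overlaps U s, weight T == 3 &
      autocorrs T == autocorrs U])
  (masks 1)) (masks 3).
Proof. by vm_compute. Qed.

(** Passing to the complement of a 4-subset subtracts 1 from each
    autocorrelation, so the complement and [U] are triples whose autocorrelations
    add up to 2 everywhere: both must be (1,1,1). *)
Lemma quad_autocorr_fano :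
  all (fun F => all (fun U =>
  (add_seq (autocorrs F) (autocorrs U) == [:: 3; 3; 3]) ==> fano U)
  (masks 3)) (masks 4).
Proof. by vm_compute. Qed.

(** The values of [f] add up to 6 and those of its sum with the indicators of [X1],
    [X2] and [G] to 12, so that this sum is 3 at four positions and 0 elsewhere.
    As [f] vanishes at three positions only if [Z] is a pair with the step d of
    [U] as its difference, [f] is (1,2,2,1) along a progression of step d, which
    is then [G].  The difference d
    occurs three times in [G] and once in [Z]. *)
Lemma quad_of_progression :
  all (fun U => fano U || all (fun Z => let f := overlaps U Z in
  all (fun X1 => let c1 := add_seq f (indicator X1) in
    all (fun X2 => let c := add_seq c1 (indicator X2) in
      if ~~ all completable c then true else
      let G := [seq v == 2 | v <- c] in
      (weight G == 4) ==> has (fun v => 3 < v) (add_seq (autocorrs Z) (autocorrs G)))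
  (masks 1)) (masks 1)) (masks 2)) (masks 3).
Proof. by vm_compute. Qed.

(** As before, the total 12 confines everything to a progression of four terms
    with the step d of [U], where [f] is (1,2,2,1).  Both triples contain its
    ends, and each of them has one of the two inner terms, which differ by d. *)
Lemma triples_of_progression :
  all (fun U => fano U || all (fun Z => let f := overlaps U Z in
  all (fun X => let c := add_seq f (indicator X) in
      if ~~ all completable c then true else
      let Y := [seq v == 2 | v <- c] in
      (weight Y == 3) ==>
      let d := ap_step U in
      ((mask_sum X + d) %% 7 == mask_sum Y %% 7) || (mask_sum X %% 7 == (mask_sum Y + d) %% 7))
  (masks 3)) (masks 2)) (masks 3).
Proof. by vm_compute. Qed.

Lemma reflect_mask_facts :
  all (fun m => all (fun w => let n := reflect_mask w m in
  [&& weight n == weight m, autocorrs n == autocorrs m &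
      (mask_sum n + mask_sum m) %% 7 == (weight m * w) %% 7])
  (iota 0 7)) (bitseqs 7).
Proof. by vm_compute. Qed.

Lemma double_mask_facts :
  all (fun m =>
  (weight (double_mask m) == weight m) &&
  (mask_sum (double_mask m) %% 7 == (2 * mask_sum m) %% 7))
  (bitseqs 7).
Proof. by vm_compute. Qed.

Lemma point_overlaps :
  all (fun s => all (fun m =>
  overlaps s m == indicator (reflect_mask (index true s) m)) (bitseqs 7)) (masks 1).
Proof. by vm_compute. Qed.

Lemma sum_over_shifts :
  all (fun m => all (fun z =>
   sumn [seq nat_of_bool (bit m (z + 6 * b)) | b <- iota 0 7] == weight m) (iota 0 7))
  (bitseqs 7).
Proof. by vm_compute. Qed.

Lemma light_autocorrs :
  all (fun k => all (fun m =>
  autocorrs m == [:: 0; 0; 0]) (masks k)) [:: 0; 1].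
Proof. by vm_compute. Qed.

Lemma masks0 : masks 0 = [:: nseq 7 false]. Proof. by vm_compute. Qed.

Lemma weight_shift_mask :
  all (fun m => all (fun b =>
  weight (shift_mask b m) == weight m) (iota 0 7)) (bitseqs 7).
Proof. by vm_compute. Qed.

Lemma sumn_iotaE (F : nat -> nat) n :
  sumn [seq F z | z <- iota 0 n] = \sum_(z <- iota 0 n) F z.
Proof. by rewrite sumnE big_map. Qed.

Lemma weightE m : size m = 7 -> weight m = \sum_(z <- iota 0 7) nth false m z.
Proof.
move=> sm; rewrite -sumn_iotaE -{1}(mkseq_nth false m) sm /mkseq.
by elim: (iota 0 7) => //= z s ->.
Qed.

Lemma overlapE m n : overlap m n = \sum_(z <- iota 0 7) nth false m z * nth false n z.
Proof.
rewrite /overlap -sum1_count big_mkcond; apply: eq_bigr => z _.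
by case: (nth _ m z); case: (nth _ n z).
Qed.

Lemma nth_shift_mask b m z : z < 7 -> nth false (shift_mask b m) z = bit m (z + 6 * b).
Proof. by move=> z7; rewrite (nth_map 0) ?size_iota // nth_iota. Qed.

Lemma sum_overlap_shift m n : size m = 7 -> size n = 7 ->
  \sum_(b <- iota 0 7) overlap m (shift_mask b n) = weight m * weight n.
Proof.
move=> sm sn; rewrite (eq_bigr _ (fun b _ => overlapE m (shift_mask b n))) exchange_big.
rewrite (weightE sm) big_distrl; apply: eq_big_seq => z.
rewrite mem_iota => /andP[_ z7]; rewrite -big_distrr /=; congr (_ * _).
have /allP/(_ n) := sum_over_shifts; rewrite -sn mem_bitseqs => /(_ isT)/allP/(_ z).
rewrite sn mem_iota => /(_ z7)/eqP <-.
by rewrite sumn_iotaE; apply: eq_bigr => b _; rewrite nth_shift_mask.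
Qed.

Lemma sum7 (F : nat -> nat) : \sum_(k <- iota 0 7) F k
  = F 0 + (F 1 + (F 2 + (F 3 + (F 4 + (F 5 + F 6))))).
Proof. by rewrite !big_cons big_nil addn0. Qed.

Lemma weight0 m : size m = 7 -> weight m = 0 -> m = nseq 7 false.
Proof.
move=> sm wm; have := mem_masks sm wm.
by rewrite masks0 inE => /eqP.
Qed.

Lemma overlap0m m : overlap (nseq 7 false) m = 0.
Proof. by []. Qed.

Lemma overlapm0 m : overlap m (nseq 7 false) = 0.
Proof.
rewrite overlapE big_seq big1 // => z _.
by rewrite nth_nseq if_same muln0.
Qed.

Lemma autocorr_light m d : size m = 7 -> weight m <= 1 ->
  d \in [:: 1; 2; 3] -> autocorr m d = 0.
Proof.
move=> sm wm; have : autocorrs m = [:: 0; 0; 0].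
  have /allP/(_ (weight m)) := light_autocorrs.
  rewrite !inE -ltnS ltnS leq_eqVlt ltnS leqn0 orbC in wm *.
  by move/(_ wm)/allP/(_ m (mem_masks sm (erefl _)))/eqP.
by case=> a1 a2 a3; rewrite !inE => /or3P[] /eqP->.
Qed.

Lemma eq_seq3 (x y z u v w : nat) :
  x = u -> y = v -> z = w -> [:: x; y; z] = [:: u; v; w].
Proof. by move=> -> -> ->. Qed.

Lemma index_lt7 m : size m = 7 -> weight m = 1 -> index true m < 7.
Proof.
move=> <- wm; rewrite index_mem -has_pred1 has_count.
suff -> : count_mem true m = weight m by rewrite wm.
by apply: eq_count => -[].
Qed.

Lemma point_cross s m k : size s = 7 -> weight s = 1 -> size m = 7 -> k < 7 ->
  overlap s (shift_mask k m) = nth false (reflect_mask (index true s) m) k.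
Proof.
move=> ss ws sm k7; have /allP/(_ s (mem_masks ss ws))/allP/(_ m) := point_overlaps.
rewrite -{1}sm mem_bitseqs => /(_ isT)/eqP/(congr1 (fun l => nth 0 l k)).
by rewrite (nth_map 0) ?size_iota // nth_iota // (nth_map false) // size_map size_iota.
Qed.

Lemma size_reflect_mask w m : size (reflect_mask w m) = 7.
Proof. by rewrite size_map size_iota. Qed.

Lemma reflect_maskE w m : w < 7 -> size m = 7 ->
  [/\ weight (reflect_mask w m) = weight m, autocorrs (reflect_mask w m) = autocorrs m &
      mask_sum (reflect_mask w m) + mask_sum m = weight m * w %[mod 7]].
Proof.
move=> w7 sm; have /allP/(_ m) := reflect_mask_facts; rewrite -{1}sm mem_bitseqs.
move/(_ isT)/allP/(_ w); rewrite mem_iota => /(_ w7).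
by case/and3P=> /eqP -> /eqP -> /eqP ->.
Qed.

Lemma nth_overlaps m n k : k < 7 -> nth 0 (overlaps m n) k = overlap m (shift_mask k n).
Proof. by move=> k7; rewrite (nth_map 0) ?size_iota // nth_iota. Qed.

Lemma nth_indicator m k : size m = 7 -> k < 7 -> nth 0 (indicator m) k = nth false m k.
Proof. by move=> sm k7; rewrite (nth_map false) // sm. Qed.

Lemma size_indicator m : size (indicator m) = size m. Proof. exact: size_map. Qed.
Lemma size_overlaps m n : size (overlaps m n) = 7.
Proof. by rewrite size_map size_iota. Qed.

Lemma autocorrsE m n d : autocorrs m = autocorrs n ->
  d \in [:: 1; 2; 3] -> autocorr m d = autocorr n d.
Proof. by case=> e1 e2 e3; rewrite !inE => /or3P[] /eqP->. Qed.

Lemma mask_sum_double m : size m = 7 -> mask_sum (double_mask m) = 2 * mask_sum m %[mod 7].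
Proof.
move=> sm; have /allP/(_ m) := double_mask_facts; rewrite -{1}sm mem_bitseqs.
by move/(_ isT)/andP=> [_ /eqP].
Qed.

(** Adding the first, third and fifth relation, the multiples of [a] cancel modulo
    7 since 1 + 2 + 4 = 7, and what remains is 3 (w0 + w1 + w2).  The other three
    relations give the same right-hand side, so that three terms [g] with signs
    add up to 0 modulo 7; but an odd number between -3 and 3 times [g] does not
    vanish. *)
Lemma signs_odd a b w0 w1 w2 r01 r02 r11 r12 r20 r21 g :
  r01 + a = 3 * w1 %[mod 7] -> r02 + b = 3 * w2 %[mod 7] ->
  r11 + 2 * a = 3 * w2 %[mod 7] -> r12 + 2 * b = 3 * w0 %[mod 7] ->
  r20 + 4 * a = 3 * w0 %[mod 7] -> r21 + 4 * b = 3 * w1 %[mod 7] ->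
  0 < g < 4 ->
  r01 + g = r02 %[mod 7] \/ r01 = r02 + g %[mod 7] ->
  r11 + g = r12 %[mod 7] \/ r11 = r12 + g %[mod 7] ->
  r20 + g = r21 %[mod 7] \/ r20 = r21 + g %[mod 7] -> False.
Proof.
move=> h1 h2 h3 h4 h5 h6 g3 c1 c2 c3.
have e1 : (r01 + r11 + r20) = (r02 + r12 + r21) %[mod 7] by clear c1 c2 c3; lia.
clear h1 h2 h3 h4 h5 h6; case: c1; case: c2; case: c3; lia.
Qed.

(** * Row weights *)

(** The vectors of [n] entries with sum [s] and sum of squares at most [q]; pruning
    by both quantities keeps the enumeration short.  Entries stop at 5, enough as
    long as [q < 36]. *)
Fixpoint bounded_vectors n s q : seq (seq nat) :=
  if q < s then [::] else if n is n'.+1 then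
    flatten [seq [seq e :: v | v <- bounded_vectors n' (s - e) (q - e * e)]
            | e <- iota 0 6 & (e <= s) && (e * e <= q)]
  else if s == 0 then [:: [::]] else [::].

Definition inner (u v : seq nat) := sumn [seq p.1 * p.2 | p <- zip u v].
(** The effect on row weights of the automorphism of order 3: it fixes the first
    two rows and rotates the two triples of rows. *)
Definition turn (v : seq nat) :=
  let a i := nth 0 v i in [:: a 0; a 1; a 4; a 2; a 3; a 7; a 5; a 6].
(** The norm of the row weights of a block is 12 plus six intersections of
    distinct blocks, each 0 or 3.  The block and its image under the automorphism
    of order 3 are either in the same orbit under the automorphism of order 7,
    and then have the same row weights, or in two orbits, and then the inner
    product is a sum of seven intersections. *)
Definition feasible v := [&& 3 %| inner v v, inner v v <= 30 &
   (turn v == v) || ((3 %| inner v (turn v)) && (inner v (turn v) <= 21))].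
Definition rotations (u : seq nat) := [:: u; seq.rot 1 u; seq.rot 2 u].

Lemma mem_bounded_vectors n s q v : q < 36 -> size v = n -> sumn v = s ->
  inner v v <= q -> v \in bounded_vectors n s q.
Proof.
have le_sum u : sumn u <= inner u u.
  by elim: u => //= e u; apply: leq_add; case: e => // e; rewrite leq_pmulr.
elim: n s q v => [|n IHn] s q [|e v] // q36 => [_ <- //|[sv] es].
rewrite [inner _ _]/(e * e + inner v v) => eq.
have -> : bounded_vectors n.+1 s q = if q < s then [::] else
    flatten [seq [seq e :: v | v <- bounded_vectors n (s - e) (q - e * e)]
            | e <- iota 0 6 & (e <= s) && (e * e <= q)] by [].
rewrite ltnNge (_ : s <= q); last by rewrite -es; apply: (leq_trans (le_sum (e :: v)) eq).
have e2 : e * e <= q by apply: leq_trans eq; apply: leq_addr.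
have e6 : e < 6.
  rewrite ltnNge; apply: contraL q36 => e6.
  by rewrite -leqNgt (leq_trans _ e2) // (leq_mul e6 e6).
apply/flattenP; exists [seq e :: u | u <- bounded_vectors n (s - e) (q - e * e)].
  apply/mapP; exists e => //; rewrite mem_filter mem_iota e2 -es leq_addr; exact: e6.
apply: map_f; apply: IHn => //.
- exact: leq_ltn_trans (leq_subr _ _) q36.
- by rewrite -es addKn.
- by rewrite leq_subRL // addnC addnC.
Qed.

(** The feasible vectors starting with (3,3), resp. (0,0), that are not invariant
    under [turn]. *)
Definition types33 :=
  [seq [:: 3; 3] ++ u ++ [:: 1; 1; 1] | u <- rotations [:: 3; 0; 0]] ++
  [seq [:: 3; 3; 1; 1; 1] ++ u | u <- rotations [:: 3; 0; 0]].
Definition types00 :=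
  [seq [:: 0; 0] ++ u ++ [:: 2; 2; 2] | u <- rotations [:: 0; 3; 3] ++ rotations [:: 4; 1; 1]] ++
  [seq [:: 0; 0; 2; 2; 2] ++ u | u <- rotations [:: 0; 3; 3] ++ rotations [:: 4; 1; 1]].

Lemma feasible_vectors :
  all (fun v => feasible v ==>
  let x := nth 0 v 0 in let y := nth 0 v 1 in
  [&& (x, y) \in [:: (0,0); (0,3); (3,0); (3,3); (1,2); (2,1)],
      21 < inner v v,
      (x == 3) && (y == 3) ==>
        if turn v == v then
          v \in [:: [:: 3;3;1;1;1;1;1;1]; [:: 3;3;2;2;2;0;0;0]; [:: 3;3;0;0;0;2;2;2]]
        else v \in types33 &
      (x == 0) && (y == 0) ==>
        if turn v == v then
          v \in [:: [:: 0;0;2;2;2;2;2;2]; [:: 0;0;3;3;3;1;1;1]; [:: 0;0;1;1;1;3;3;3]]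
        else v \in types00]) (bounded_vectors 8 12 30).
Proof. by vm_compute. Qed.

(** * Triples of points *)

Section Design.

Variables (T : finType) (BB : {set {set T}}).
Hypothesis cardT : #|T| = 56.
Hypothesis block_size : forall C, C \in BB -> #|C| = 12.
Hypothesis pair_count : forall p q, p != q ->
  #|[set C in BB | (p \in C) && (q \in C)]| = 9.
Hypothesis block_meet : forall C D, C \in BB -> D \in BB -> C != D ->
  #|C :&: D| = 0 \/ #|C :&: D| = 3.

Definition through p := [set C in BB | p \in C].
Definition through2 p q := [set C in through p | q \in C].
Definition through3 p q r := [set C in through2 p q | r \in C].

Lemma in_through p C : (C \in through p) = (C \in BB) && (p \in C).
Proof. by rewrite inE. Qed.

Lemma in_through2 p q C :
  (C \in through2 p q) = [&& C \in BB, p \in C & q \in C].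
Proof. by rewrite inE in_through andbA. Qed.

Lemma card_through2 p q : p != q -> #|through2 p q| = 9.
Proof.
move=> pq; rewrite -(pair_count pq); apply: eq_card => C.
by rewrite !inE andbA.
Qed.

Lemma card_through p : #|through p| = 45.
Proof.
have := sum_incidence (through p) (~: [set p]).
rewrite (eq_bigr (fun=> 9)); last first.
  by move=> q; rewrite !inE => qp; rewrite -(@card_through2 p q) // eq_sym.
rewrite [RHS](eq_bigr (fun=> 11)); last first.
  move=> C; rewrite in_through => /andP[CB pC]; have := cardsD1 p C.
  rewrite pC block_size // setIC -setDE => /eqP; rewrite eqSS => /eqP <- //.
by rewrite !sum_nat_const cardsC1 cardT; lia.
Qed.

Lemma card_blocks : #|BB| = 210.
Proof.
have := sum_incidence BB setT.
rewrite (eq_bigr (fun=> 45)); last by move=> q _; apply: card_through.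
rewrite [RHS](eq_bigr (fun=> 12)); last by move=> C CB; rewrite setTI block_size.
by rewrite !sum_nat_const cardsT cardT; lia.
Qed.

Lemma meet_through p C D : C \in through p -> D \in through p -> C != D ->
  #|C :&: D| = 3.
Proof.
rewrite !in_through => /andP[CB pC] /andP[DB pD] CD.
case: (block_meet CB DB CD) => // /eqP; rewrite cards_eq0 => /eqP E.
by have := in_set0 p; rewrite -E inE pC pD.
Qed.

(** Fix [p] and [q], and let lam x be the number of the 9 blocks on [p] and [q] that
    contain x.  Two of these blocks share exactly one further point, so over the
    54 other points the sum of lam is 9 * 10 = 90 and that of its squares is
    9 * (10 + 8) = 162.  Hence the sum of (lam - 1) (lam - 2) is
    162 - 270 + 108 = 0, and as its terms are nonnegative they all vanish. *)
Lemma triple_cover p q r : uniq [:: p; q; r] -> 0 < #|through3 p q r| <= 2.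
Proof.
rewrite /= !inE negb_or !andbT => /andP[/andP[pq pr] qr].
set A := through2 p q; have cA : #|A| = 9 by apply: card_through2.
pose S := ~: [set p; q].
pose lam x := #|[set C in A | x \in C]|.
have inA C : C \in A -> [/\ C \in through p, p \in C & q \in C].
  by rewrite in_through2 in_through => /and3P[-> -> ->].
have cS (C : {set T}) : p \in C -> q \in C -> #|S :&: C| = #|C| - 2.
  move=> pC qC; rewrite setIC -setDE cardsD (setIidPr _); last first.
    by apply/subsetP=> x; rewrite !inE => /orP[] /eqP->.
  by rewrite cards2 pq.
have s1 : \sum_(x in S) lam x = 90.
  rewrite sum_incidence (eq_bigr (fun=> 10)) ?sum_nat_const ?cA // => C CA.
  have [CB pC qC] := inA _ CA; rewrite cS // block_size //.
  by move: CB; rewrite in_through => /andP[].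
have s2 : \sum_(x in S) lam x * lam x = 162.
  have -> : \sum_(x in S) lam x * lam x
          = \sum_(C in A) \sum_(x in S :&: C) lam x.
    have -> : \sum_(x in S) lam x * lam x
        = \sum_(x in S) \sum_(C in A) (if x \in C then lam x else 0).
      apply: eq_bigr => x _; rewrite -big_mkcondr /= sum_nat_const.
      by rewrite {1}/lam cardsE.
    rewrite exchange_big; apply: eq_bigr => C _ /=; rewrite -big_mkcondr.
    by apply: eq_bigl => x; rewrite !inE.
  rewrite (eq_bigr (fun=> 18)) ?sum_nat_const ?cA // => C CA.
  have [Cp pC qC] := inA _ CA.
  rewrite sum_incidence (bigD1 C) //= -setIA setIid cS //.
  rewrite block_size; last by move: Cp; rewrite in_through => /andP[].
  rewrite (eq_bigr (fun=> 1)).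
    have := cardsD1 C A; rewrite cA CA sum1dep_card => c1.
    suff -> : #|[set D in A | D != C]| = #|A :\ C| by lia.
    by apply: eq_card => D; rewrite !inE andbC.
  move=> D /andP[DA DC]; have [Dp pD qD] := inA _ DA.
  by rewrite -setIA cS ?inE ?pC ?qC ?pD ?qD // (meet_through Cp Dp) // eq_sym.
have cSS : #|S| = 54.
  by have := cardsC [set p; q]; rewrite -/S cards2 pq cardT /=; lia.
have s3 : \sum_(x in S) (lam x * lam x + 2 - 3 * lam x) = 0.
  rewrite sumnB => [|x _]; last by case: (lam x) => [|[|n]] //; nia.
  by rewrite big_split /= -big_distrr /= s1 s2 sum_nat_const cSS.
have rS : r \in S by rewrite !inE negb_or eq_sym pr eq_sym.
move/eqP: s3; rewrite sum_nat_eq0 => /forallP/(_ r); rewrite rS implyTb -/(lam r).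
by rewrite /through3 -/A -/(lam r); case: (lam r) => [|[|[|n]]] //; rewrite -/(_ == 0) => /eqP; nia.
Qed.

(** * Automorphisms of prime order *)

Section Automorphism.

Variable g : {perm T}.
Hypothesis g_aut : forall C, C \in BB -> g @: C \in BB.

Definition fixed_through p := [set C in through p | g @: C == C].

Lemma in_fixed_through p C :
  (C \in fixed_through p) = [&& C \in BB, p \in C & g @: C == C].
Proof. by rewrite inE in_through andbA. Qed.

Lemma aut_through p C : g p = p -> C \in through p -> g @: C \in through p.
Proof.
move=> gp; rewrite !in_through => /andP[/g_aut-> pC] /=.
by rewrite -gp imset_f.
Qed.

(** The points counted are those [q] with [g q] in C and in [g @: C], except for [p]
    itself; two distinct blocks through [p] meet in 3 points. *)
Lemma card_moved_pairs p C : g p = p -> C \in through p ->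
  #|[set q in ~: [set p] | (q \in C) && (g q \in C)]|
    = if g @: C == C then 11 else 2.
Proof.
move=> gp Cp; have gCp := aut_through gp Cp.
have -> : [set q in ~: [set p] | (q \in C) && (g q \in C)]
        = (g @^-1: (C :&: g @: C)) :\ p.
  apply/setP=> q; rewrite !inE (mem_imset _ _ (@perm_inj _ g)).
  by rewrite [(g q \in C) && _]andbC.
have pC : p \in g @^-1: (C :&: g @: C).
  by move: Cp gCp; rewrite !in_through !inE gp => /andP[_ ->] /andP[_ ->].
have := cardsD1 p (g @^-1: (C :&: g @: C)).
rewrite pC card_preimset; last exact: perm_inj.
case: eqP => [-> | /eqP gC].
  by rewrite setIid block_size; [case | move: Cp; rewrite in_through => /andP[]].
rewrite (meet_through Cp gCp) 1?eq_sym //; by case.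
Qed.

(** Let t blocks through [p] be fixed, and count the pairs of a point [q], different
    from [p], and a block through [p], [q] and [g q].  Counted by blocks there are
    11 t + 2 (45 - t) of them.  Counted by points, each fixed [q] contributes 9, and
    each moved [q] contributes 1 or 2 since three distinct points are on one or
    two blocks. *)
Lemma fixed_bounds p : g p = p ->
  8 * #|fixed_points g| <= 43 + 9 * #|fixed_through p| /\
  9 * #|fixed_through p| <= 13 + 7 * #|fixed_points g|.
Proof.
move=> gp; pose S := ~: [set p].
set t := #|fixed_through p|; set f := #|fixed_points g|.
pose mu q := #|[set C in through p | (q \in C) && (g q \in C)]|.
have sum_mu : \sum_(q in S) mu q = 90 + 9 * t.
  have -> : \sum_(q in S) mu q
      = \sum_(C in through p) #|[set q in S | (q \in C) && (g q \in C)]|.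
    rewrite (eq_bigr (fun q => \sum_(C in through p)
               ((q \in C) && (g q \in C) : nat))); last first.
      move=> q _; rewrite /mu -sum1_card big_mkcond [RHS]big_mkcond /=.
      apply: eq_bigr => C _; rewrite inE.
      by case: (C \in _); case: (q \in C); case: (g q \in C).
    rewrite exchange_big; apply: eq_bigr => C _ /=.
    rewrite -sum1_card big_mkcond [RHS]big_mkcond /=.
    apply: eq_bigr => q _; rewrite inE.
    by case: (q \in S); case: (q \in C); case: (g q \in C).
  rewrite (eq_bigr (fun C : {set T} => 2 + 9 * (g @: C == C))); last first.
    by move=> C Cp; rewrite card_moved_pairs //; case: (_ == _).
  rewrite big_split /= sum_nat_const card_through // -big_distrr /=.
  by congr (_ + 9 * _); rewrite -big_mkcondr sum1_card /t cardsE.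
have cF : #|fixed_points g :\ p| + 1 = f.
  by rewrite /f (cardsD1 p (fixed_points g)) inE gp eqxx addnC.
have cN : #|S :\: fixed_points g| + f = 56.
  have := cardsC (fixed_points g); rewrite cardT -/f addnC => <-; congr (_ + _).
  by apply: eq_card => x; rewrite !inE; have [->|] := eqVneq x p; rewrite ?gp ?eqxx ?andbT.
rewrite (big_setID (fixed_points g)) /= in sum_mu.
have sF : \sum_(q in S :&: fixed_points g) mu q = 9 * (f - 1).
  rewrite (eq_bigr (fun=> 9)) => [|q].
    rewrite sum_nat_const mulnC -cF addnK; congr (_ * _).
    by apply: eq_card => x; rewrite !inE.
  rewrite !inE => /andP[qp /eqP gq].
  rewrite -(card_through2 (p := p) (q := q)) 1?eq_sym //.
  by apply: eq_card => C; rewrite !inE gq andbb.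
have sN : #|S :\: fixed_points g| <= \sum_(q in S :\: fixed_points g) mu q
            <= 2 * #|S :\: fixed_points g|.
  have mu12 q : q \in S :\: fixed_points g -> 0 < mu q <= 2.
    rewrite !inE => /andP[gq qp].
    have := @triple_cover p q (g q).
    rewrite /= !inE negb_or !andbT eq_sym qp /=.
    rewrite [q == _]eq_sym gq -{1}gp (inj_eq (@perm_inj _ g)) eq_sym qp => /(_ isT).
    suff -> : #|through3 p q (g q)| = mu q by [].
    by apply: eq_card => C; rewrite !inE andbA.
  apply/andP; split.
    by rewrite -sum1_card; apply: leq_sum => q /mu12/andP[].
  by rewrite mulnC -sum_nat_const; apply: leq_sum => q /mu12/andP[].
rewrite -/t -/f; lia.
Qed.

(** The blocks through three fixed points are one or two in number, and a group of
    odd prime order that permutes them has to fix each of them. *)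
Lemma fixed_triple r p q x : prime r -> odd r -> (g ^+ r = 1)%g ->
  uniq [:: p; q; x] -> g p = p -> g q = q -> g x = x ->
  exists C, [/\ C \in fixed_through p, q \in C & x \in C].
Proof.
move=> r_pr r_odd gr u gp gq gx.
have := triple_cover u.
set A := through3 p q x => A12.
have gA C : C \in A -> g @: C \in A.
  rewrite !inE -!andbA => /and4P[CB pC qC xC].
  by rewrite g_aut // -{1}gp -{1}gq -{1}gx !imset_f.
have := card_fixed_sets_mod r_pr gr gA.
have [-> | [C]] := set_0Vmem [set C in A | g @: C == C].
  rewrite cards0 mod0n => /esym/eqP E.
  have r3 : 2 < r by case: r r_pr r_odd {gr E} => [|[|[|r']]].
  by move: E; rewrite modn_small; [case: #|A| A12 | lia].
rewrite inE => /andP[CA gC] _; exists C; move: CA.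
by rewrite inE in_through2 in_fixed_through => /andP[/and3P[-> -> ->] ->]; rewrite gC.
Qed.

(** By the previous lemma the fixed blocks through [p] cover every ordered pair of
    distinct further fixed points. *)
Lemma fixed_coverage r p : prime r -> odd r -> (g ^+ r = 1)%g -> g p = p ->
  (#|fixed_points g| - 1) * (#|fixed_points g| - 2)
  <= \sum_(C in fixed_through p) (#|C :&: fixed_points g| - 1) * (#|C :&: fixed_points g| - 2).
Proof.
move=> r_pr r_odd gr gp; set F := fixed_points g; set A := fixed_through p.
have pF : p \in F by rewrite inE gp.
have cFp : #|F :\ p| = #|F| - 1 by rewrite (cardsD1 p F) pF; lia.
have cC (C : {set T}) : C \in A -> #|(F :\ p) :&: C| = #|C :&: F| - 1.
  rewrite in_fixed_through => /and3P[_ pC _].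
  have := cardsD1 p (C :&: F); rewrite inE pC pF /= => ->.
  by rewrite add1n subn1 /=; apply: eq_card => x; rewrite !inE; lia.
have -> : \sum_(C in A) (#|C :&: F| - 1) * (#|C :&: F| - 2)
    = \sum_(q in F :\ p) \sum_(C in A | q \in C) (#|C :&: F| - 2).
  rewrite (exchange_big_dep (mem A)) /=; last by move=> q C _ /andP[].
  apply: eq_bigr => C CA; rewrite CA -cC // -sum_nat_const.
  by apply: eq_bigl => q; rewrite !inE.
rewrite -cFp -sum_nat_const; apply: leq_sum => q qF.
have [qp gq] : q != p /\ g q = q by move: qF; rewrite !inE => /andP[? /eqP].
set A' := [set C in A | q \in C].
have -> : \sum_(C in A | q \in C) (#|C :&: F| - 2)
        = \sum_(C in A') #|(F :\ p :\ q) :&: C|.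
  apply: eq_big => [C | C /andP[CA qC]]; first by rewrite !inE.
  have := cardsD1 q ((F :\ p) :&: C); rewrite cC // inE qF qC /= => E.
  suff -> : (F :\ p :\ q) :&: C = ((F :\ p) :&: C) :\ q by lia.
  by apply/setP=> x; rewrite !inE !andbA.
rewrite -sum_incidence.
have cFq : #|F :\ p :\ q| = #|F| - 2.
  by have := cardsD1 q (F :\ p); rewrite qF cFp; lia.
rewrite -cFq -sum1_card; apply: leq_sum => x.
rewrite !inE => /and3P[xq xp /eqP gx].
have [|C [CA qC xC]] := fixed_triple r_pr r_odd gr _ gp gq gx.
  by rewrite /= !inE negb_or !andbT [p == q]eq_sym qp [p == x]eq_sym xp eq_sym.
by apply/card_gt0P; exists C; rewrite !inE in CA *; rewrite CA qC xC.
Qed.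

Let F := fixed_points g.

Lemma block_meet_le3 C D : C \in BB -> D \in BB -> C != D -> #|C :&: D| <= 3.
Proof. by move=> CB DB /(block_meet CB DB)[] ->. Qed.

Lemma block_meet_fixed_mod r C : prime r -> (g ^+ r = 1)%g ->
  C \in BB -> g @: C == C -> #|C :&: F| = 12 %[mod r].
Proof. by move=> r_pr gr CB /eqP gC; rewrite (card_fixed_points_mod r_pr gr gC) block_size. Qed.

Lemma fixed_through_mod r p : prime r -> (g ^+ r = 1)%g -> g p = p ->
  #|fixed_through p| = 45 %[mod r].
Proof.
move=> r_pr gr gp.
rewrite (card_fixed_sets_mod r_pr gr) ?card_through //.
by move=> C; apply: aut_through.
Qed.

Lemma fixed_points_mod r : prime r -> (g ^+ r = 1)%g -> #|F| = 56 %[mod r].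
Proof.
move=> r_pr gr; rewrite -cardT -cardsT -(setTI F) (card_fixed_points_mod r_pr gr) //.
by apply/setP=> x; rewrite inE; apply/imsetP; exists (g^-1 x)%g; rewrite ?permKV.
Qed.

Lemma sum_through_fixed (A : {set {set T}}) :
  \sum_(p in F) #|[set C in A | p \in C]| = \sum_(C in A) #|C :&: F|.
Proof. by rewrite sum_incidence; apply: eq_bigr => C _; rewrite setIC. Qed.

(** Let f be the number of fixed points and t the number of fixed blocks through
    one of them.  Congruences modulo 7 and the two bounds leave (f,t) = (7,3),
    (14,10) or (21,17), and a fixed block has 5 or 12 fixed points.
    For f = 7 the incidences of fixed points and fixed blocks would number
    21 = 5 n.  In the other cases the coverage of pairs, where a block
    contributes (5-1)(5-2) = 12 or (12-1)(12-2) = 110 = 12 + 98, forces each fixed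
    point to be on at least one (f = 14), resp. two (f = 21), blocks consisting of
    fixed points.  Then there are at least two, resp. three, such blocks, and
    since they meet in at most 3 points their union has at least 21 > 14, resp.
    27 > 21, points. *)
Lemma order7_fixed_points : (g ^+ 7 = 1)%g -> g != 1%g -> F = set0.
Proof.
move=> g7 g1; apply/eqP; apply: contraT => /set0Pn[p0 p0F].
have pr7 : prime 7 by [].
have f7 := fixed_points_mod pr7 g7.
have f0 : 0 < #|F| by apply/card_gt0P; exists p0.
have fT : #|F| < 56.
  rewrite ltnNge -cardT; apply: contra g1 => FT; apply/eqP/permP=> x.
  have /setP/(_ x) : F = setT by apply/eqP; rewrite eqEcard subsetT cardsT.
  by rewrite perm1 !inE => /eqP.
have mC C : C \in BB -> g @: C == C -> #|C :&: F| = 5 \/ #|C :&: F| = 12.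
  move=> CB gC; have := block_meet_fixed_mod pr7 g7 CB gC.
  by have := subset_leq_card (subsetIl C F); rewrite (block_size CB); lia.
have ft p : p \in F -> let t := #|fixed_through p| in
    [\/ #|F| = 7 /\ t = 3, #|F| = 14 /\ t = 10 | #|F| = 21 /\ t = 17].
  rewrite inE => /eqP gp; have := fixed_through_mod pr7 g7 gp.
  have := fixed_bounds gp.
  rewrite -/F /=; set t := #|fixed_through _|; move=> [b1 b2] t7.
  have [k kf] : exists k, #|F| = 7 * k by exists (#|F| %/ 7); lia.
  have : 0 < k < 8 by lia.
  move: kf b1 b2; case: k => [|[|[|[|[|[|[|[|k]]]]]]]] // kf b1 b2 k8.
  - by constructor 1; lia.
  - by constructor 2; lia.
  - by constructor 3; lia.
  - by exfalso; lia.
  - by exfalso; lia.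
  - by exfalso; lia.
  - by exfalso; lia.
have [f_7 | f_n7] := eqVneq #|F| 7.
  pose A := [set C in BB | g @: C == C].
  have := sum_through_fixed A.
  rewrite (eq_bigr (fun=> 3)); last first.
    move=> p /[dup] pF /ft; rewrite f_7 => -[] [//] _ <-.
    by apply: eq_card => C; rewrite !inE andbAC.
  rewrite [RHS](eq_bigr (fun=> 5)); last first.
    move=> C; rewrite inE => /andP[CB gC]; case: (mC C CB gC) => // m12.
    by have := subset_leq_card (subsetIr C F); lia.
  by rewrite !sum_nat_const f_7; lia.
pose A := [set C in BB | (g @: C == C) && (C \subset F)].
have AB C : C \in A -> C \in BB by rewrite inE => /andP[].
have AF C : C \in A -> C \subset F by rewrite inE => /and3P[].
have kA p : p \in F -> (#|F| - 1) * (#|F| - 2)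
    <= 12 * #|fixed_through p| + 98 * #|[set C in A | p \in C]|.
  rewrite inE => /eqP gp; rewrite /F.
  apply: leq_trans (fixed_coverage pr7 isT g7 gp) _.
  (* 12 = (5 - 1) (5 - 2) and 12 + 98 = (12 - 1) (12 - 2) *)
  rewrite (eq_bigr (fun C : {set T} => 12 + 98 * (C \subset F))); last first.
    move=> C; rewrite in_fixed_through => /and3P[CB _ gC]; rewrite -/F.
    have -> : (C \subset F) = (#|C :&: F| == 12).
      by rewrite (sameP setIidPl eqP) eqEcard subsetIl (block_size CB) /=;
         case: (mC C CB gC) => ->.
    by case: (mC C CB gC) => ->.
  rewrite big_split /= sum_nat_const mulnC -big_distrr /= leq_add2l leq_mul2l /=.
  rewrite -big_mkcondr sum1_card; apply: subset_leq_card; apply/subsetP=> C.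
  rewrite -topredE /= in_fixed_through => /andP[/and3P[CB pC gC] CF].
  by rewrite !inE CB gC CF pC.
have sA : \sum_(p in F) #|[set C in A | p \in C]| = 12 * #|A|.
  rewrite sum_through_fixed (eq_bigr (fun=> 12)) ?sum_nat_const 1?mulnC // => C CA.
  by rewrite (setIidPl (AF _ CA)) block_size // AB.
have meetA C D : C \in A -> D \in A -> C != D -> #|C :&: D| <= 3.
  by move=> CA DA; apply: block_meet_le3; apply: AB.
have [f_14 | f_n14] := eqVneq #|F| 14.
  have : 14 <= 12 * #|A|.
    rewrite -sA -[14]muln1 -f_14 -sum_nat_const; apply: leq_sum => p pF.
    by have := kA p pF; have := ft p pF; rewrite f_14 => -[] [//] _ ->; lia.
  have [/card_gt1P[C [D [CA DA CD]]] _|] := ltnP 1 #|A|; last lia.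
  have := subset_leq_card (_ : C :|: D \subset F).
  rewrite subUset !AF // f_14 cardsU (block_size (AB _ CA)) (block_size (AB _ DA)) => /(_ isT).
  by have := meetA _ _ CA DA CD; clear; lia.
have f_21 : #|F| = 21.
  by case: (ft _ p0F) => -[f _] //; move: f_n7 f_n14; rewrite f.
have : 42 <= 12 * #|A|.
  rewrite -sA -[42]/(21 * 2) -f_21 -sum_nat_const; apply: leq_sum => p pF.
  by have := kA p pF; have := ft p pF; rewrite f_21 => -[] [//] _ ->; lia.
have [/card_gt2P[C [D [E [[CA DA EA] [CD DE EC]]]]] _|] := ltnP 2 #|A|; last lia.
have := subset_leq_card (_ : C :|: D :|: E \subset F).
rewrite !subUset !AF // f_21 => /(_ isT).
rewrite cardsU setIUl (cardsU C D) (block_size (AB _ CA)) (block_size (AB _ DA))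
  (block_size (AB _ EA)).
have := meetA _ _ CA DA CD; have := meetA _ _ DA EA DE; have := meetA _ _ EA CA EC.
have := leq_of_leqif (leq_card_setU (C :&: E) (D :&: E)).
rewrite [E :&: C]setIC; move: #|_ :|: D :&: E| #|C :&: D| #|C :&: E| #|D :&: E|.
by clear; lia.
Qed.

(** The congruence leaves 2, 5 and 8 fixed points.  If there are 5, a fixed block
    through one of them contains 3, and at most 3 such blocks cannot cover the 12
    ordered pairs of other fixed points.  If there are 8, there are at most 6
    fixed blocks through a fixed point; they contain 3 fixed points, except for
    at most one that contains 6, as two of those would have a union of at least 9
    points.  They cover at most 5 * 2 + 20 = 30 of the 42 pairs. *)
Lemma order3_fixed_points : (g ^+ 3 = 1)%g -> #|F| <= 8 -> #|F| = 2.
Proof.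
move=> g3 f8; have pr3 : prime 3 by [].
have f3 := fixed_points_mod pr3 g3.
have [p pF] : exists p, p \in F by apply/card_gt0P; lia.
have gp : g p = p by move: pF; rewrite inE => /eqP.
have t3 := fixed_through_mod pr3 g3 gp.
have [_ b2] := fixed_bounds gp.
have cov := fixed_coverage pr3 isT g3 gp.
rewrite -/F in b2 cov; set A := fixed_through p in t3 b2 cov.
have AB C : C \in A -> C \in BB by rewrite in_fixed_through => /andP[].
have mC C : C \in A -> #|C :&: F| = 3 \/ (#|C :&: F| = 6 /\ #|F| = 8).
  rewrite in_fixed_through => /and3P[CB pC gC].
  have := block_meet_fixed_mod pr3 g3 CB gC.
  have := subset_leq_card (subsetIr C F).
  have : 0 < #|C :&: F| by apply/card_gt0P; exists p; rewrite inE pC.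
  by move: f8 f3; clear; lia.
have [//|[f5|f8']] : #|F| = 2 \/ #|F| = 5 \/ #|F| = 8 by lia.
  move: cov; rewrite (eq_bigr (fun=> 2)); last by move=> C /mC [] [->] //; lia.
  by rewrite sum_nat_const f5; lia.
pose A6 := [set C in A | #|C :&: F| == 6].
have A6_1 : #|A6| <= 1.
  rewrite leqNgt; apply/negP=> /card_gt1P[C [D []]].
  rewrite ![_ \in A6]inE => /andP[CA /eqP C6] /andP[DA /eqP D6] CD.
  have := subset_leq_card (_ : (C :&: F) :|: (D :&: F) \subset F).
  rewrite subUset !subsetIr cardsU C6 D6 f8' => /(_ isT).
  have := subset_leq_card (_ : (C :&: F) :&: (D :&: F) \subset C :&: D).
  rewrite setISS ?subsetIl // => /(_ isT).
  by have := block_meet_le3 (AB _ CA) (AB _ DA) CD; clear; lia.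
(* 2 = (3 - 1) (3 - 2) and 2 + 18 = (6 - 1) (6 - 2) *)
move: cov; rewrite (eq_bigr (fun C : {set T} => 2 + 18 * (#|C :&: F| == 6))).
  rewrite big_split /= sum_nat_const -big_distrr /= -big_mkcondr sum1_card f8'.
  have -> : #|(fun C => (C \in A) && (#|C :&: F| == 6))| = #|A6| by rewrite /A6 cardsE.
  move: t3 b2 A6_1; rewrite f8'; move: #|A| #|A6| => a b; clear => a3 b2 b1 c.
  have : a <= 6 by lia.
  by lia.
by move=> C /mC [->|[-> _]].
Qed.

End Automorphism.

(** * Orbits of the automorphism of order 7 *)

Section Frobenius.

Variables (sigma phi : {perm T}).
Hypothesis sigma7 : (sigma ^+ 7 = 1)%g.
Hypothesis sigma_free : forall x, sigma x != x.
Hypothesis phi3 : forall x, phi (phi (phi x)) = x.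
Hypothesis phi_sigma : forall x, phi (sigma x) = sigma (sigma (phi x)).

Local Notation st z := (iter z sigma).

Lemma st_mod z x : st (z %% 7) x = st z x.
Proof.
rewrite {2}(divn_eq z 7) addnC iterD iterM; congr (st _ _); apply/esym.
by apply: iter_fix; rewrite -permX sigma7 perm1.
Qed.

Lemma st_fix z x : st z x = x -> z %% 7 = 0.
Proof.
rewrite -st_mod => zx; apply/eqP; apply: contraT => z0.
have : (z %% 7) \in iota 1 6 by rewrite mem_iota lt0n z0 ltn_pmod.
have fix1 k : (k * (z %% 7)) %% 7 = 1 -> False.
  by move=> k1; have := sigma_free x; rewrite -{1}[sigma x]/(st 1 x) -k1 st_mod iterM iter_fix ?eqxx.
rewrite !inE => /orP[/eqP E|/orP[/eqP E|/orP[/eqP E|/orP[/eqP E|/orP[/eqP E|/eqP E]]]]].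
- by case: (fix1 1); rewrite E.
- by case: (fix1 4); rewrite E.
- by case: (fix1 5); rewrite E.
- by case: (fix1 2); rewrite E.
- by case: (fix1 3); rewrite E.
- by case: (fix1 6); rewrite E.
Qed.

Lemma st_inj y z x : st y x = st z x -> y = z %[mod 7].
Proof.
move=> yz; have : st (y + 6 * z) x = x.
  by rewrite addnC iterD yz -iterD addnC -mulSn -st_mod modnMr.
by move/st_fix; lia.
Qed.

Lemma phi_st z x : phi (st z x) = st (2 * z) (phi x).
Proof. by elim: z x => // z IHz x; rewrite iterS phi_sigma IHz mulnS. Qed.

(** Points of a row are addressed as [st z x] from a base point [x], with [z] modulo 7. *)
Definition row x := porbit sigma x.

Lemma rowP x y : reflect (exists z, y = st z x) (y \in row x).
Proof.
by apply: (iffP (porbitP sigma x y)) => -[z ->]; exists z; rewrite permX.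
Qed.

Lemma row_eq x y : (row x == row y) = (x \in row y).
Proof. exact: eq_porbit_mem. Qed.

Lemma row_phi x y : (row (phi x) == row (phi y)) = (row x == row y).
Proof.
have h u v : u \in row v -> phi u \in row (phi v).
  by case/rowP=> z ->; apply/rowP; exists (2 * z); rewrite phi_st.
rewrite !row_eq; apply/idP/idP; last exact: h.
by move/h/h; rewrite !phi3.
Qed.

(** In such a row [phi] acts on residues as an affine map of slope 2, which has a
    fixed point. *)
Lemma row_phi_fixed x : row (phi x) == row x -> exists2 y, phi y = y & row y == row x.
Proof.
rewrite row_eq => /rowP[z pz]; exists (st (6 * z) x).
  by rewrite phi_st pz -iterD -[LHS]st_mod -[RHS]st_mod; congr (st _ _); lia.
by rewrite row_eq; apply/rowP; exists (6 * z).
Qed.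

(** From the first fixed point, [phi] acts on the residues of the row as doubling,
    which fixes only 0. *)
Lemma fixed_same_row x y : phi x = x -> phi y = y -> row x == row y -> x = y.
Proof.
move=> px py; rewrite row_eq => /rowP[z xz].
have : st (2 * z) y = st z y by rewrite -{1}py -phi_st -xz px.
move/st_inj => zz; rewrite xz -st_mod.
by have -> : z %% 7 = 0 by lia.
Qed.

Lemma card_fixed_points_le8 : #|fixed_points phi| <= 8.
Proof.
pose F := fixed_points phi; pose pt (w : T * 'I_7) := iter w.2 sigma w.1.
have : #|pt @: setX F [set: 'I_7]| <= 56 by rewrite -cardT max_card.
rewrite card_in_imset; first by rewrite cardsX cardsT card_ord /F; lia.
move=> [x z] [y z']; rewrite !inE !andbT /= => /eqP px /eqP py E.
have xy : x = y.
  apply: (fixed_same_row px py); rewrite row_eq.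
  apply/rowP; exists (6 * z + z'); rewrite iterD -[iter z' _ _]E -iterD.
  by rewrite addnC -mulSn -st_mod modnMr.
move: E; rewrite /pt /= -xy => /st_inj.
by rewrite !modn_small // => /val_inj ->.
Qed.

Definition row_mask (C : {set T}) x := [seq st z x \in C | z <- iota 0 7].

Lemma size_row_mask C x : size (row_mask C x) = 7.
Proof. by rewrite size_map size_iota. Qed.

Lemma bit_row_mask C x z : bit (row_mask C x) z = (st z x \in C).
Proof.
by rewrite /bit /row_mask (nth_map 0) ?size_iota ?nth_iota ?ltn_pmod // st_mod.
Qed.

Lemma nth_row_mask C x z : z < 7 -> nth false (row_mask C x) z = (st z x \in C).
Proof. by move=> z7; rewrite -bit_row_mask /bit modn_small. Qed.

Lemma row_mask_translate b (C : {set T}) x :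
  row_mask ((sigma ^+ b)%g @: C) x = shift_mask b (row_mask C x).
Proof.
apply: eq_map => z; rewrite bit_row_mask.
have -> : st z x = (sigma ^+ b)%g (st (z + 6 * b) x).
  by rewrite permX -iterD -[LHS]st_mod -[RHS]st_mod; congr (st _ _); lia.
by rewrite mem_imset //; apply: perm_inj.
Qed.

(** Here 4 is the inverse of 2 modulo 7. *)
Lemma row_mask_phi (C : {set T}) x : row_mask (phi @: C) (phi x) = double_mask (row_mask C x).
Proof.
apply: eq_map => z; rewrite bit_row_mask.
have -> : st z (phi x) = phi (st (4 * z) x).
  by rewrite phi_st -[LHS]st_mod -[RHS]st_mod; congr (st _ _); lia.
by rewrite mem_imset //; apply: perm_inj.
Qed.

Variables (p q : T).
Hypothesis phip : phi p = p.
Hypothesis phiq : phi q = q.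
Hypothesis pq : p != q.
Hypothesis phi_fixed : forall x, phi x = x -> x = p \/ x = q.

(** A frame picks one base point in each row, in such a way that [phi] maps base
    points to base points; then [phi] acts on all rows by doubling. *)
Definition base_points b c := [:: p; q; b; phi b; phi (phi b); c; phi c; phi (phi c)].
Definition frame b c := uniq [seq row x | x <- base_points b c].

Lemma frame_sym b c : frame b c -> frame c b.
Proof.
rewrite /frame -(perm_uniq (s1 := [seq row x | x <- base_points c b])) //.
apply: perm_map; rewrite /base_points !perm_cons -cat1s -[x in perm_eq _ x]cat1s.
by rewrite -[[:: b; _; _]]/([:: b; phi b; phi (phi b)]) (perm_catC [:: c; phi c; phi (phi c)]).
Qed.

(** The rows other than those of [p] and [q] contain no fixed point, so [phi] moves
    them in cycles of length 3.  Take [b] in one of them and [c] outside of all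
    rows reached so far: each row has at most 7 points, so seven rows do not
    exhaust the 56 points. *)
Lemma frame_exists : exists b c, frame b c.
Proof.
have card_row x : #|row x| <= 7.
  have -> : row x = [set st z x | z : 'I_7].
    apply/setP=> y; apply/rowP/imsetP => [[z ->] | [z _ ->]]; last by exists z.
    by exists (Ordinal (ltn_pmod z (isT : 0 < 7))) => //; rewrite /= st_mod.
  by apply: leq_trans (leq_imset_card _ _) _; rewrite card_ord.
have escape s : size s <= 7 -> exists x, all (fun y => row x != row y) s.
  move=> s7; pose U := \bigcup_(y <- s) row y.
  have U56 : #|U| <= 7 * size s.
    rewrite /U; move: (s); elim=> [|y u IHu]; first by rewrite big_nil cards0.
    rewrite big_cons; apply: leq_trans (leq_of_leqif (leq_card_setU _ _)) _.
    by rewrite mulnS leq_add.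
  have /set0Pn[x] : ~: U != set0.
    by rewrite -card_gt0 cardsCs setCK cardT; lia.
  rewrite inE => xU; exists x; apply/allP=> y ys; apply: contra xU.
  by rewrite row_eq => xy; rewrite /U (perm_big _ (perm_to_rem ys)) big_cons inE xy.
have row_phi3 x y : (row (phi (phi x)) == row y) = (row x == row (phi y)).
  by rewrite -row_phi phi3.
have orbit3 x : row x != row p -> row x != row q -> row (phi x) != row x.
  move=> xp xq; apply/negP=> /row_phi_fixed[y /phi_fixed[->|->]]; rewrite eq_sym.
    exact/negP.
  exact/negP.
have [b /and3P[bp bq _]] := escape [:: p; q] isT.
have [c /and5P[cp cq cb cb1 /andP[cb2 _]]] :=
  escape [:: p; q; b; phi b; phi (phi b)] isT.
have b1 := orbit3 b bp bq; have c1 := orbit3 c cp cq.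
have pqr : row p != row q by apply: contra pq => /(fixed_same_row phip phiq)/eqP.
have Rp x : (row (phi x) == row p) = (row x == row p) by rewrite -{1}phip row_phi.
have Rq x : (row (phi x) == row q) = (row x == row q) by rewrite -{1}phiq row_phi.
have R1 x : (row (phi (phi x)) == row x) = (row (phi x) == row x).
  by rewrite row_phi3 eq_sym.
have S x y : (row x != row y) = (row y != row x) by rewrite eq_sym.
have n1 : row b != row (phi b) by rewrite S.
have n2 : row b != row (phi (phi b)) by rewrite S R1.
have n3 : row c != row (phi c) by rewrite S.
have n4 : row c != row (phi (phi c)) by rewrite S R1.
have n5 : row b != row c by rewrite S.
have n6 : row b != row (phi c) by rewrite S -row_phi row_phi3.
have n7 : row b != row (phi (phi c)) by rewrite S row_phi3.
have n8 : row (phi b) != row c by rewrite S.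
have n9 : row (phi (phi b)) != row c by rewrite S.
exists b, c; rewrite /frame /= !inE !negb_or !andbT ![row p == _]eq_sym.
rewrite ![row q == _]eq_sym !Rp !Rq bp bq cp cq n1 n2 n3 n4 n5 n6 n7 n8 n9.
by rewrite !row_phi n1 n3 n5 n6 n8 pqr.
Qed.

Definition row_weights b c (C : {set T}) := [seq weight (row_mask C x) | x <- base_points b c].

Lemma card_frame b c (C : {set T}) : frame b c ->
  #|C| = \sum_(x <- base_points b c) \sum_(z <- iota 0 7) (st z x \in C).
Proof.
move=> bc; pose pts := [seq st z x | x <- base_points b c, z <- iota 0 7].
have u_pts : uniq pts.
  apply: allpairs_uniq; [exact: map_uniq bc | exact: iota_uniq |].
  move=> _ _ /allpairsP[[x y] [xs yi ->]] /allpairsP[[x' y'] [xs' yi' ->]] /= E.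
  have xx : x = x'.
    apply: (uniq_map_inj_in bc) => //; apply/eqP; rewrite row_eq.
    apply/rowP; exists (6 * y + y'); rewrite iterD -E -iterD addnC -mulSn.
    by rewrite -[RHS]st_mod modnMr.
  move: E; rewrite -{}xx => /st_inj.
  by move: yi yi'; rewrite !mem_iota /= => y7 y7'; rewrite !modn_small // => ->.
have pts_T : perm_eq pts (enum T).
  apply: uniq_perm; rewrite ?enum_uniq //.
  have sub : {subset pts <= enum T} by move=> x _; rewrite mem_enum.
  have le : size (enum T) <= size pts.
    by rewrite size_allpairs size_iota -cardE cardT.
  by have [_] := uniq_min_size u_pts sub le.
rewrite -sum1_card big_mkcond -big_enum (perm_big pts) 1?perm_sym //=.
rewrite big_allpairs_dep; apply: eq_bigr => x _; apply: eq_bigr => z _.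
by case: (_ \in C).
Qed.

Lemma cardI_frame b c (C D : {set T}) : frame b c ->
  #|C :&: D| = \sum_(x <- base_points b c) overlap (row_mask C x) (row_mask D x).
Proof.
move=> bc; rewrite (card_frame _ bc); apply: eq_bigr => x _.
rewrite overlapE; apply: eq_big_seq => z; rewrite mem_iota => /andP[_ z7].
by rewrite !nth_row_mask // in_setI; case: (_ \in C); case: (_ \in D).
Qed.

Lemma weight_row_maskE C x : weight (row_mask C x) = \sum_(z <- iota 0 7) (st z x \in C).
Proof.
rewrite weightE ?size_row_mask //; apply: eq_big_seq => z; rewrite mem_iota => /andP[_ z7].
by rewrite nth_row_mask.
Qed.

Lemma sumn_row_weights b c (C : {set T}) : frame b c -> sumn (row_weights b c C) = #|C|.
Proof.
move=> bc; rewrite (card_frame _ bc) sumnE big_map; apply: eq_bigr => x _.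
exact: weight_row_maskE.
Qed.

Lemma row_weights_phi b c (C : {set T}) :
  row_weights b c (phi @: C) = turn (row_weights b c C).
Proof.
have w x : weight (row_mask (phi @: C) (phi x)) = weight (row_mask C x).
  rewrite row_mask_phi; have /allP/(_ (row_mask C x)) := double_mask_facts.
  by rewrite -{1}(size_row_mask C x) mem_bitseqs => /(_ isT)/andP[/eqP].
have w3 x : weight (row_mask (phi @: C) x) = weight (row_mask C (phi (phi x))).
  by rewrite -{1}[x]phi3 w.
have wp : weight (row_mask (phi @: C) p) = weight (row_mask C p) by rewrite -{1}phip w.
have wq : weight (row_mask (phi @: C) q) = weight (row_mask C q) by rewrite -{1}phiq w.
rewrite /row_weights /turn /base_points; do !rewrite [map _ (_ :: _)]map_cons.
rewrite wp wq !w w3 (w3 c) /nth.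
by [].
Qed.

(** In each row, the overlaps of a set with all translates of another one add up
    to the product of the two sizes. *)
Lemma inner_row_weights b c (C D : {set T}) : frame b c ->
  inner (row_weights b c C) (row_weights b c D)
    = \sum_(k <- iota 0 7) #|C :&: ((sigma ^+ k)%g @: D)|.
Proof.
move=> bc.
rewrite (eq_bigr _ (fun k _ => cardI_frame C ((sigma ^+ k)%g @: D) bc)) exchange_big.
transitivity (\sum_(x <- base_points b c) weight (row_mask C x) * weight (row_mask D x)).
  by rewrite /inner /row_weights zip_map -map_comp sumnE big_map.
apply: eq_bigr => x _; rewrite -sum_overlap_shift ?size_row_mask //; apply: eq_bigr => k _.
by rewrite row_mask_translate.
Qed.

(** * Distribution of the row weights *)

Hypothesis sigma_aut : forall C, C \in BB -> sigma @: C \in BB.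
Hypothesis phi_aut : forall C, C \in BB -> phi @: C \in BB.

Local Notation translate k C := ((sigma ^+ k)%g @: C).

Lemma translate0 (C : {set T}) : translate 0 C = C.
Proof.
by rewrite expg0 -[RHS]imset_id; apply: eq_imset => x; rewrite perm1.
Qed.

Lemma translate_block k C : C \in BB -> translate k C \in BB.
Proof.
move=> CB; elim: k => [|k IHk]; first by rewrite translate0.
have -> : translate k.+1 C = sigma @: translate k C; last exact: sigma_aut.
by rewrite -imset_comp; apply: eq_imset => x; rewrite expgSr permM.
Qed.

(** Since 7 does not divide 12, a set of 12 points cannot be invariant under a
    permutation of order 7 without fixed points. *)
Lemma translate_neq k C : C \in BB -> k \in iota 1 6 -> C != translate k C.
Proof.
rewrite mem_iota => CB k6; apply/eqP=> Ck.
have pr7 : prime 7 by [].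
have k71 : ((sigma ^+ k) ^+ 7 = 1)%g by rewrite -expgM mulnC expgM sigma7 expg1n.
have := card_fixed_points_mod pr7 k71 (esym Ck).
have -> : fixed_points (sigma ^+ k)%g = set0.
  apply/setP=> x; rewrite !inE permX; apply/eqP=> /st_fix; lia.
by rewrite setI0 cards0 block_size.
Qed.

Lemma meet03 C D : C \in BB -> D \in BB -> C != D -> #|C :&: D| \in [:: 0; 3].
Proof. by move=> CB DB /(block_meet CB DB)[] ->. Qed.

Lemma meet_translate C k : C \in BB -> k \in iota 1 6 -> #|C :&: translate k C| \in [:: 0; 3].
Proof. by move=> CB k6; rewrite meet03 ?translate_block ?translate_neq. Qed.

Section InFrame.

Variables (b c : T).
Hypothesis bc : frame b c.

Lemma weight_translate (C : {set T}) k x : k < 7 ->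
  weight (row_mask (translate k C) x) = weight (row_mask C x).
Proof.
move=> k7; rewrite row_mask_translate //; have /allP/(_ (row_mask C x)) := weight_shift_mask.
rewrite -{1}(size_row_mask C x) mem_bitseqs => /(_ isT)/allP/(_ k).
by rewrite mem_iota => /(_ k7)/eqP.
Qed.

Lemma row_weights_translate (C : {set T}) k : k < 7 ->
  row_weights b c (translate k C) = row_weights b c C.
Proof. by move=> k7; apply: eq_map => x; apply: weight_translate. Qed.

Lemma norm_row_weights C : C \in BB -> inner (row_weights b c C) (row_weights b c C)
  = 12 + \sum_(k <- iota 1 6) #|C :&: translate k C|.
Proof.
by move=> CB; rewrite inner_row_weights // big_cons translate0 setIid block_size.
Qed.

Lemma inner_distinct_orbits C D : C \in BB -> D \in BB ->
  (forall k, k < 7 -> C <> translate k D) ->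
  (3 %| inner (row_weights b c C) (row_weights b c D)) &&
  (inner (row_weights b c C) (row_weights b c D) <= 21).
Proof.
move=> CB DB CD; rewrite inner_row_weights // sum7.
have h k : k < 7 -> #|C :&: translate k D| = 0 \/ #|C :&: translate k D| = 3.
  by move=> k7; apply: block_meet => //; [exact: translate_block | apply/eqP/CD].
by move: (h 0 isT) (h 1 isT) (h 2 isT) (h 3 isT) (h 4 isT) (h 5 isT) (h 6 isT);
  clear; lia.
Qed.

Lemma same_orbit_of_inner C D : C \in BB -> D \in BB ->
  21 < inner (row_weights b c C) (row_weights b c D) ->
  exists2 k : 'I_7, true & C = translate k D.
Proof.
move=> CB DB ip; have [/existsP[k /eqP Ck] | /existsPn no] :=
  boolP [exists k : 'I_7, C == translate k D]; first by exists k.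
have : (3 %| inner (row_weights b c C) (row_weights b c D)) &&
    (inner (row_weights b c C) (row_weights b c D) <= 21).
  by apply: inner_distinct_orbits => // k k7 E; have := no (Ordinal k7); rewrite -E eqxx.
by rewrite leqNgt ip andbF.
Qed.

Lemma feasible_row_weights C : C \in BB -> feasible (row_weights b c C).
Proof.
move=> CB; apply/and3P; rewrite norm_row_weights // !big_cons big_nil.
have h k : k \in iota 1 6 -> #|C :&: translate k C| = 0 \/ #|C :&: translate k C| = 3.
  by move=> k6; apply: block_meet; [| exact: translate_block | exact: translate_neq].
move: (h 1 isT) (h 2 isT) (h 3 isT) (h 4 isT) (h 5 isT) (h 6 isT) => h1 h2 h3 h4 h5 h6.
split; [by clear -h1 h2 h3 h4 h5 h6; lia | by clear -h1 h2 h3 h4 h5 h6; lia |].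
rewrite -(row_weights_phi b c C).
have [/existsP[k /eqP Ck] | /existsPn no] :=
  boolP [exists k : 'I_7, C == translate k (phi @: C)].
  by rewrite {2}Ck row_weights_translate // eqxx.
apply/orP; right; apply: inner_distinct_orbits => //; first exact: phi_aut.
by move=> k k7 E; have := no (Ordinal k7); rewrite -E eqxx.
Qed.

Lemma row_weights_bounded C : C \in BB -> row_weights b c C \in bounded_vectors 8 12 30.
Proof.
move=> CB; apply: mem_bounded_vectors => //; last by case/and3P: (feasible_row_weights CB).
by rewrite sumn_row_weights // block_size.
Qed.

Lemma pair_countE x y : #|[set C in BB | (x \in C) && (y \in C)]|
  = if x == y then 45 else 9.
Proof.
have [<- | xy] := eqVneq x y; last exact: pair_count.
rewrite -(card_through x).
by apply: eq_card => C; rewrite !inE andbb.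
Qed.

Lemma sum_weight x : \sum_(C in BB) weight (row_mask C x) = 315.
Proof.
rewrite (eq_bigr _ (fun (C : {set T}) _ => weight_row_maskE C x)) exchange_big.
rewrite (eq_bigr (fun=> 45)) => [|z _]; first by rewrite sum7.
rewrite -(card_through (st z x)) -sum1_card.
rewrite [RHS](eq_bigl (fun C : {set T} => (C \in BB) && (st z x \in C))); last first.
  by move=> C; rewrite in_through.
by rewrite big_mkcondr; apply: eq_bigr => C _; case: (_ \in C).
Qed.

Lemma sum_weight2 x y : \sum_(C in BB) weight (row_mask C x) * weight (row_mask C y)
  = \sum_(z <- iota 0 7) \sum_(z' <- iota 0 7) (if st z x == st z' y then 45 else 9).
Proof.
transitivity (\sum_(C in BB) \sum_(z <- iota 0 7) \sum_(z' <- iota 0 7)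
    ((st z x \in C) && (st z' y \in C) : nat)).
  apply: eq_bigr => C _; rewrite !weight_row_maskE big_distrl; apply: eq_bigr => z _.
  by rewrite big_distrr; apply: eq_bigr => z' _; exact: mulnb.
rewrite exchange_big; apply: eq_bigr => z _.
rewrite exchange_big; apply: eq_bigr => z' _.
rewrite -pair_countE -sum1_card.
rewrite [RHS](eq_bigl (fun C : {set T} =>
  (C \in BB) && ((st z x \in C) && (st z' y \in C)))); last first.
  by move=> C; rewrite inE.
by rewrite [RHS]big_mkcondr; apply: eq_bigr => C _; case: (_ && _).
Qed.

Lemma sum_weight_sq x : \sum_(C in BB) weight (row_mask C x) * weight (row_mask C x) = 693.
Proof.
rewrite sum_weight2.
rewrite (eq_big_seq (fun z => \sum_(z' <- iota 0 7) (if z == z' then 45 else 9))).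
  by rewrite sum7 !sum7.
move=> z; rewrite mem_iota => /andP[_ z7]; apply: eq_big_seq => z'.
rewrite mem_iota => /andP[_ z7']; congr (if _ then _ else _).
by apply/eqP/eqP => [/st_inj | -> //]; rewrite !modn_small.
Qed.

Lemma sum_weight_pq : \sum_(C in BB) weight (row_mask C p) * weight (row_mask C q) = 441.
Proof.
rewrite sum_weight2.
rewrite (eq_bigr (fun=> \sum_(z' <- iota 0 7) 9)); first by rewrite sum7 !sum7.
move=> z _; apply: eq_bigr => z' _; case: eqP => // E.
case/negP: pq; apply/eqP; apply: (fixed_same_row phip phiq).
rewrite row_eq; apply/rowP; exists (6 * z + z').
by rewrite iterD -E -iterD addnC -mulSn -st_mod modnMr.
Qed.

Let wp (C : {set T}) := weight (row_mask C p).
Let wq (C : {set T}) := weight (row_mask C q).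

Lemma row_weights_type C : C \in BB ->
  [/\ (wp C, wq C) \in [:: (0,0); (0,3); (3,0); (3,3); (1,2); (2,1)],
      21 < inner (row_weights b c C) (row_weights b c C),
      wp C = 3 -> wq C = 3 -> row_weights b c C \in types33 ++
        [:: [:: 3;3;1;1;1;1;1;1]; [:: 3;3;2;2;2;0;0;0]; [:: 3;3;0;0;0;2;2;2]] &
      wp C = 0 -> wq C = 0 -> row_weights b c C \in types00 ++
        [:: [:: 0;0;2;2;2;2;2;2]; [:: 0;0;3;3;3;1;1;1]; [:: 0;0;1;1;1;3;3;3]]].
Proof.
move=> CB; have /allP/(_ _ (row_weights_bounded CB)) := feasible_vectors.
rewrite feasible_row_weights // implyTb; set v := row_weights b c C.
have -> : nth 0 v 0 = wp C by []; have -> : nth 0 v 1 = wq C by [].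
move=> /and4P[xy n21 h33 h00]; split=> // x0 y0; rewrite mem_cat.
  move: h33; rewrite x0 y0 !eqxx !implyTb.
  by case: (turn v == v) => ->; rewrite ?orbT.
move: h00; rewrite x0 y0 !eqxx !implyTb.
by case: (turn v == v) => ->; rewrite ?orbT.
Qed.

(** For the six possible pairs (x,y) one has xy + x^2 = 3 x + 9 [x = y = 3] and
    x + y + 3 [x = y = 0] = 3 + 3 [x = y = 3], with brackets for truth values.
    Summing these identities over all blocks gives 441 + 693 = 3 * 315 + 9 n33 and
    2 * 315 + 3 n00 = 3 * 210 + 3 n33. *)
Lemma card_33_00 : #|[set C in BB | (wp C == 3) && (wq C == 3)]| = 21 /\
  #|[set C in BB | (wp C == 0) && (wq C == 0)]| = 21.
Proof.
set n33 := #|_|; set n00 := #|[set _ in _ | (_ == 0) && _]|.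
have n33E : n33 = \sum_(C in BB) ((wp C == 3) && (wq C == 3)).
  rewrite /n33 -sum1_card
    (eq_bigl (fun C : {set T} => (C \in BB) && ((wp C == 3) && (wq C == 3)))).
    by rewrite big_mkcondr; apply: eq_bigr => C _; case: (_ && _).
  by move=> C; rewrite inE.
have n00E : n00 = \sum_(C in BB) ((wp C == 0) && (wq C == 0)).
  rewrite /n00 -sum1_card
    (eq_bigl (fun C : {set T} => (C \in BB) && ((wp C == 0) && (wq C == 0)))).
    by rewrite big_mkcondr; apply: eq_bigr => C _; case: (_ && _).
  by move=> C; rewrite inE.
have e1 : \sum_(C in BB) (wp C * wq C + wp C * wp C)
        = \sum_(C in BB) (3 * wp C + 9 * ((wp C == 3) && (wq C == 3))).
  apply: eq_bigr => C CB; have [xy _ _ _] := row_weights_type CB.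
  by move: xy; rewrite !inE !xpair_eqE;
     do ![case/orP] => /andP[/eqP-> /eqP->].
have e2 : \sum_(C in BB) (wp C + wq C + 3 * ((wp C == 0) && (wq C == 0)))
        = \sum_(C in BB) (3 + 3 * ((wp C == 3) && (wq C == 3))).
  apply: eq_bigr => C CB; have [xy _ _ _] := row_weights_type CB.
  by move: xy; rewrite !inE !xpair_eqE;
     do ![case/orP] => /andP[/eqP-> /eqP->].
have add (F G : {set T} -> nat) :
    \sum_(C in BB) (F C + G C) = \sum_(C in BB) F C + \sum_(C in BB) G C.
  exact: big_split.
have mul k (F : {set T} -> nat) :
    \sum_(C in BB) k * F C = k * \sum_(C in BB) F C by rewrite big_distrr.
pose i33 (C : {set T}) : nat := (wp C == 3) && (wq C == 3).
pose i00 (C : {set T}) : nat := (wp C == 0) && (wq C == 0).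
rewrite (add (fun C => wp C * wq C) (fun C => wp C * wp C)) in e1.
rewrite (add (fun C => 3 * wp C) (fun C => 9 * i33 C)) (mul 3 wp) (mul 9 i33) in e1.
rewrite (add (fun C => wp C + wq C) (fun C => 3 * i00 C)) (add wp wq) in e2.
rewrite (add (fun=> 3) (fun C => 3 * i33 C)) (mul 3 i00) (mul 3 i33) in e2.
move: e1 e2; rewrite -n33E -n00E sum_weight_pq sum_weight_sq !sum_weight.
rewrite sum_nat_const; move: n33 n00 {n33E n00E}.
by rewrite card_blocks; clear; lia.
Qed.

(** Such blocks are translates of each other. *)
Lemma card_class v : 21 < inner v v -> #|[set C in BB | row_weights b c C == v]| <= 7.
Proof.
move=> v21; have [->|[C]] := set_0Vmem [set C in BB | row_weights b c C == v].
  by rewrite cards0.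
rewrite inE => /andP[CB /eqP vC].
apply: (@leq_trans #|[set translate k C | k : 'I_7]|).
  apply: subset_leq_card; apply/subsetP=> D; rewrite inE => /andP[DB /eqP vD].
  have [k _ ->] : exists2 k : 'I_7, true & D = translate k C.
    by apply: same_orbit_of_inner; rewrite ?vC ?vD.
  exact: imset_f.
by apply: leq_trans (leq_imset_card _ _) _; rewrite card_ord.
Qed.

(** Each of the three vectors is shared by at most 7 blocks, and the first two
    cannot both occur: their inner product exceeds 21, so the blocks would be
    translates of each other and have the same vector.  This accounts for at most
    14 of the 21 blocks. *)
Lemma outside_three_classes v1 v2 v3 (S : {set {set T}}) : S \subset BB -> #|S| = 21 ->
  21 < inner v1 v1 -> 21 < inner v2 v2 -> 21 < inner v3 v3 -> 21 < inner v1 v2 ->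
  v1 != v2 -> exists2 C, C \in S & row_weights b c C \notin [:: v1; v2; v3].
Proof.
move=> SB S21 n1 n2 n3 n12 v12.
have [/exists_inP[C CS vC] | /exists_inPn no] :=
  boolP [exists C in S, row_weights b c C \notin [:: v1; v2; v3]]; first by exists C.
pose N v := [set C in BB | row_weights b c C == v].
have SN : #|S| <= #|N v1| + #|N v2| + #|N v3|.
  apply: (@leq_trans #|N v1 :|: N v2 :|: N v3|); last first.
    have := leq_of_leqif (leq_card_setU (N v1 :|: N v2) (N v3)).
    have := leq_of_leqif (leq_card_setU (N v1) (N v2)); lia.
  apply: subset_leq_card; apply/subsetP=> C CS; have := no C CS.
  by rewrite negbK !inE (subsetP SB _ CS) /= orbA.
have := card_class n1; have := card_class n2; have := card_class n3.
rewrite -/(N v1) -/(N v2) -/(N v3).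
have [N1 | [C]] := set_0Vmem (N v1); first by move: SN; rewrite N1 cards0; lia.
have [N2 | [D]] := set_0Vmem (N v2); first by move: SN; rewrite N2 cards0; lia.
rewrite !inE => /andP[DB /eqP vD] /andP[CB /eqP vC].
have [|k _ E] := same_orbit_of_inner CB DB; first by rewrite vC vD.
by case/negP: v12; rewrite -vC -vD E row_weights_translate.
Qed.

Lemma exists_33 : exists2 C, C \in BB & row_weights b c C \in types33.
Proof.
have [n33 _] := card_33_00.
have [] := @outside_three_classes [:: 3;3;1;1;1;1;1;1] [:: 3;3;2;2;2;0;0;0]
  [:: 3;3;0;0;0;2;2;2] _ _ n33 => //.
  by apply/subsetP=> C; rewrite inE => /andP[].
move=> C; rewrite inE => /and3P[CB /eqP xC /eqP yC] vC; exists C => //.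
have [_ _ /(_ xC yC) h _] := row_weights_type CB.
by move: h; rewrite mem_cat (negbTE vC) orbF.
Qed.

Lemma exists_00 : exists2 C, C \in BB & row_weights b c C \in types00.
Proof.
have [_ n00] := card_33_00.
have [] := @outside_three_classes [:: 0;0;2;2;2;2;2;2] [:: 0;0;3;3;3;1;1;1]
  [:: 0;0;1;1;1;3;3;3] _ _ n00 => //.
  by apply/subsetP=> C; rewrite inE => /andP[].
move=> C; rewrite inE => /and3P[CB /eqP xC /eqP yC] vC; exists C => //.
have [_ _ _ /(_ xC yC) h] := row_weights_type CB.
by move: h; rewrite mem_cat (negbTE vC) orbF.
Qed.

End InFrame.

(** Replacing the block by its images under [phi] moves the entry 3 to the front of
    its triple, and exchanging [b] and [c] moves it to the first triple. *)
Lemma exists_normal_33 : exists b c, frame b c /\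
  exists2 B, B \in BB & row_weights b c B = [:: 3; 3; 3; 0; 0; 1; 1; 1].
Proof.
have [b [c bc]] : exists b c, frame b c by apply: frame_exists.
have turn b' c' (C : {set T}) : C \in BB ->
    row_weights b' c' C
      \in [seq [:: 3; 3] ++ u ++ [:: 1; 1; 1] | u <- rotations [:: 3; 0; 0]] ->
    exists2 B, B \in BB & row_weights b' c' B = [:: 3; 3; 3; 0; 0; 1; 1; 1].
  move=> CB; rewrite !inE => /or3P[] /eqP E; first by exists C.
    by exists (phi @: C); [exact: phi_aut | rewrite row_weights_phi E].
  by exists (phi @: (phi @: C)); [do 2!apply: phi_aut | rewrite !row_weights_phi E].
have [C CB] := exists_33 bc; rewrite mem_cat => /orP[] vC.
  by exists b, c; split=> //; apply: turn vC.
exists c, b; split; first exact: frame_sym.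
apply: (turn _ _ C) => //.
have -> : row_weights c b C = let a i := nth 0 (row_weights b c C) i in
    [:: a 0; a 1; a 5; a 6; a 7; a 2; a 3; a 4] by [].
by move: vC; rewrite !inE => /or3P[] /eqP->.
Qed.

Definition normal_types00 := [:: [:: 0;0;0;3;3;2;2;2]; [:: 0;0;1;1;4;2;2;2];
  [:: 0;0;2;2;2;0;3;3]; [:: 0;0;2;2;2;4;1;1]].

Lemma exists_normal_00 b c : frame b c ->
  exists2 D, D \in BB & row_weights b c D \in normal_types00.
Proof.
move=> bc; have [C CB vC] := exists_00 bc.
have : all (fun v => [|| v \in normal_types00, turn v \in normal_types00
                       | turn (turn v) \in normal_types00]) types00 by [].
move/allP/(_ _ vC)/or3P; rewrite -!row_weights_phi => -[] vD; first by exists C.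
  by exists (phi @: C) => //; apply: phi_aut.
by exists (phi @: (phi @: C)) => //; do 2!apply: phi_aut.
Qed.

Lemma autocorr_row_light C x d n : weight (row_mask C x) = n -> n <= 1 ->
  d \in [:: 1; 2; 3] -> autocorr (row_mask C x) d = 0.
Proof. by move=> wx n1; apply: autocorr_light; rewrite ?size_row_mask ?wx. Qed.

Section Contradiction.

Variables (b c : T) (B : {set T}).
Hypothesis bc : frame b c.
Hypothesis BinBB : B \in BB.
Hypothesis vB : row_weights b c B = [:: 3; 3; 3; 0; 0; 1; 1; 1].

Let wB i := congr1 (fun v => nth 0 v i) vB.
Let wBp : weight (row_mask B p) = 3 := wB 0.
Let wBq : weight (row_mask B q) = 3 := wB 1.
Let wU : weight (row_mask B b) = 3 := wB 2.
Let wB3 : weight (row_mask B (phi b)) = 0 := wB 3.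
Let wB4 : weight (row_mask B (phi (phi b))) = 0 := wB 4.
Let wB5 : weight (row_mask B c) = 1 := wB 5.
Let wB6 : weight (row_mask B (phi c)) = 1 := wB 6.
Let wB7 : weight (row_mask B (phi (phi c))) = 1 := wB 7.

Let U := row_mask B b.
Let w0 := index true (row_mask B c).
Let w1 := index true (row_mask B (phi c)).
Let w2 := index true (row_mask B (phi (phi c))).

Lemma sum_bases (F : T -> nat) : \sum_(x <- base_points b c) F x =
  F p + (F q + (F b + (F (phi b) + (F (phi (phi b)) +
  (F c + (F (phi c) + F (phi (phi c)))))))).
Proof. by rewrite !big_cons big_nil addn0. Qed.

(** A norm of 30 = 12 + 6 * 3 means that the block meets each of its other
    translates in 3 points. *)
Lemma own_autocorr C d : C \in BB -> inner (row_weights b c C) (row_weights b c C) = 30 ->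
  d \in [:: 1; 2; 3] -> \sum_(x <- base_points b c) autocorr (row_mask C x) d = 3.
Proof.
move=> CB n30 d3; transitivity #|C :&: translate d C|.
  rewrite (cardI_frame _ _ bc); apply: eq_bigr => x _.
  by rewrite row_mask_translate.
have h k : k \in iota 1 6 -> #|C :&: translate k C| <= 3.
  by move=> k6; have := meet_translate CB k6; rewrite !inE => /orP[] /eqP->.
move: n30; rewrite norm_row_weights // !big_cons big_nil.
move: (h 1 isT) (h 2 isT) (h 3 isT) (h 4 isT) (h 5 isT) (h 6 isT).
by move: d3; rewrite !inE => /or3P[] /eqP->; clear; lia.
Qed.

(** The intersection of [B] with the translates of [D], row by row.  A single point
    w of [B] is in the translate by [k] of a row M of [D] if and only if [k] is in
    w - M. *)
Lemma overlaps_with_B D k : D \in BB -> weight (row_mask D p) = 0 -> weight (row_mask D q) = 0 ->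
  k < 7 -> overlap U (shift_mask k (row_mask D b))
    + (nth false (reflect_mask w0 (row_mask D c)) k
    + (nth false (reflect_mask w1 (row_mask D (phi c))) k
    + nth false (reflect_mask w2 (row_mask D (phi (phi c)))) k)) \in [:: 0; 3].
Proof.
move=> DB Dp Dq k7; have BD : B != translate k D.
  by apply/eqP=> E; move: wBp; rewrite E weight_translate // Dp.
have := meet03 BinBB (translate_block k DB) BD.
rewrite (cardI_frame _ _ bc) sum_bases.
rewrite (weight0 (size_row_mask (translate k D) p)) ?weight_translate // overlapm0.
rewrite (weight0 (size_row_mask (translate k D) q)) ?weight_translate // overlapm0.
rewrite (weight0 (size_row_mask B (phi b))) // overlap0m.
rewrite (weight0 (size_row_mask B (phi (phi b)))) // overlap0m !row_mask_translate //.
rewrite (point_cross _ wB5) ?size_row_mask // (point_cross _ wB6) ?size_row_mask //.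
by rewrite (point_cross _ wB7) ?size_row_mask.
Qed.

(** If all autocorrelations of [U] are 1, those of the other two triples of [B] add
    up to 2, so that in the rows of [p] and [q] alone [B] meets some translate of
    [phi @: B] in more than 3 points. *)
Lemma U_not_fano : ~~ fano U.
Proof.
apply/negP=> /eqP; case=> u1 u2 u3.
have ownB d : d \in [:: 1; 2; 3] -> autocorr U d = 1 ->
    autocorr (row_mask B p) d + autocorr (row_mask B q) d = 2.
  move=> d3 Ud; have := own_autocorr BinBB; rewrite vB => /(_ d erefl d3).
  rewrite sum_bases -/U Ud (@autocorr_light (row_mask B (phi b)) d) ?size_row_mask ?wB3 //.
  rewrite (@autocorr_light (row_mask B (phi (phi b))) d) ?size_row_mask ?wB4 //.
  rewrite (@autocorr_light (row_mask B c) d) ?size_row_mask ?wB5 //.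
  rewrite (@autocorr_light (row_mask B (phi c)) d) ?size_row_mask ?wB6 //.
  rewrite (@autocorr_light (row_mask B (phi (phi c))) d) ?size_row_mask ?wB7 //.
  by clear; lia.
have /allP/(_ _ (mem_masks (size_row_mask B p) wBp)) := fano_pair_overlap.
move/allP/(_ _ (mem_masks (size_row_mask B q) wBq)).
rewrite -[add_seq (autocorrs _) _]/[:: autocorr (row_mask B p) 1 + autocorr (row_mask B q) 1;
   autocorr (row_mask B p) 2 + autocorr (row_mask B q) 2;
   autocorr (row_mask B p) 3 + autocorr (row_mask B q) 3].
rewrite !ownB // eqxx implyTb => /negP; apply.
apply/(all_nthP 0) => k; rewrite size_add_seq ?size_map ?size_iota // => k7.
rewrite nth_add_seq ?size_map ?size_iota // !(nth_map 0) ?size_iota // nth_iota // add0n.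
have BphB : B != translate k (phi @: B).
  have wb : weight (row_mask (phi @: B) b) = 0 :=
    congr1 (fun v => nth 0 v 2) (etrans (row_weights_phi b c B) (congr1 turn vB)).
  by apply/eqP=> E; have := etrans (esym wU) (etrans (congr1 (fun C => weight (row_mask C b)) E)
    (etrans (weight_translate (phi @: B) b k7) wb)).
have := block_meet BinBB (translate_block k (phi_aut BinBB)) BphB.
rewrite (cardI_frame _ _ bc) sum_bases !row_mask_translate //.
have -> : row_mask (phi @: B) p = double_mask (row_mask B p) by rewrite -{1}phip row_mask_phi.
have -> : row_mask (phi @: B) q = double_mask (row_mask B q) by rewrite -{1}phiq row_mask_phi.
by clear; lia.
Qed.

Let w0_lt : w0 < 7. Proof. exact: index_lt7 (size_row_mask _ _) wB5. Qed.
Let w1_lt : w1 < 7. Proof. exact: index_lt7 (size_row_mask _ _) wB6. Qed.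
Let w2_lt : w2 < 7. Proof. exact: index_lt7 (size_row_mask _ _) wB7. Qed.

(** [U] faces an empty row of [D], so the indicators of the three reflected pairs
    add up to 0 or 3: the pairs coincide. *)
Lemma no_033_222 D : D \in BB -> row_weights b c D <> [:: 0; 0; 0; 3; 3; 2; 2; 2].
Proof.
move=> DB vD; have wD i := congr1 (fun v => nth 0 v i) vD.
pose X0 := reflect_mask w0 (row_mask D c); pose X1 := reflect_mask w1 (row_mask D (phi c)).
pose X2 := reflect_mask w2 (row_mask D (phi (phi c))).
have [x0 a0 _] := reflect_maskE w0_lt (size_row_mask D c).
have [x1 a1 _] := reflect_maskE w1_lt (size_row_mask D (phi c)).
have [x2 a2 _] := reflect_maskE w2_lt (size_row_mask D (phi (phi c))).
have X k : k < 7 -> nth false X0 k = nth false X1 k /\ nth false X0 k = nth false X2 k.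
  move=> k7; have := overlaps_with_B DB (wD 0) (wD 1) k7.
  rewrite -row_mask_translate (weight0 (size_row_mask (translate k D) b)); last first.
    by rewrite weight_translate //; exact: (wD 2).
  rewrite overlapm0 -/X0 -/X1 -/X2.
  by case: (nth _ X0 k); case: (nth _ X1 k); case: (nth _ X2 k).
have X01 : X0 = X1.
  by apply: (eq_from_nth (x0 := false)); rewrite ?size_reflect_mask // => k /X[].
have X02 : X0 = X2.
  by apply: (eq_from_nth (x0 := false)); rewrite ?size_reflect_mask // => k /X[].
have own3 d : d \in [:: 1; 2; 3] ->
    autocorr (row_mask D (phi b)) d + autocorr (row_mask D (phi (phi b))) d
    + (autocorr X0 d + (autocorr X0 d + autocorr X0 d)) = 3.
  move=> d3; have := own_autocorr DB; rewrite vD => /(_ d erefl d3).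
  rewrite sum_bases (@autocorr_row_light D p d 0 (wD 0)) // (@autocorr_row_light D q d 0 (wD 1)) //.
  rewrite (@autocorr_row_light D b d 0 (wD 2)) //.
  have E m n : autocorrs m = autocorrs n -> autocorr m d = autocorr n d.
    by case=> e1 e2 e3; move: d3; rewrite !inE => /or3P[] /eqP->.
  by rewrite -(E _ _ a0) -(E _ _ a1) -(E _ _ a2) -/X0 -/X1 -/X2 -X01 -X02; lia.
have := equal_pairs_autocorr.
have m3 x : weight (row_mask D x) = 3 ->
    autocorrs (row_mask D x) \in undup [seq autocorrs m | m <- masks 3].
  by move=> wx; rewrite mem_undup map_f // mem_masks // size_row_mask.
move/allP/(_ _ (m3 _ (wD 3)))/allP/(_ _ (m3 _ (wD 4)))/allP/(_ (autocorrs X0)).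
rewrite mem_undup map_f ?mem_masks ?size_reflect_mask //; last by rewrite x0; exact: (wD 5).
move/(_ isT)/eqP; apply.
by apply: eq_seq3 (own3 1 isT) (own3 2 isT) (own3 3 isT).
Qed.

Let U_mask : U \in masks 3 := mem_masks (size_row_mask B b) wU.

(** [U] faces a single point of [D], which contributes a reflected copy of [U]; the
    three reflected pairs of [D] must be the pairs of that triple.  Their
    autocorrelations are then those of [U], and together with those of the
    4-subset in [D] they add up to 3, so that [U] would not be a progression. *)
Lemma no_114_222 D : D \in BB -> row_weights b c D <> [:: 0; 0; 1; 1; 4; 2; 2; 2].
Proof.
move=> DB vD; have wD i := congr1 (fun v => nth 0 v i) vD.
pose X0 := reflect_mask w0 (row_mask D c); pose X1 := reflect_mask w1 (row_mask D (phi c)).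
pose X2 := reflect_mask w2 (row_mask D (phi (phi c))).
have [x0 a0 _] := reflect_maskE w0_lt (size_row_mask D c).
have [x1 a1 _] := reflect_maskE w1_lt (size_row_mask D (phi c)).
have [x2 a2 _] := reflect_maskE w2_lt (size_row_mask D (phi (phi c))).
rewrite -/X0 -/X1 -/X2 in x0 a0 x1 a1 x2 a2.
have [sX0 sX1 sX2] : [/\ size X0 = 7, size X1 = 7 & size X2 = 7] by rewrite !size_reflect_mask.
have /allP/(_ _ U_mask)/allP/(_ _ (mem_masks (size_row_mask D b) (wD 2))) := point_in_triple.
case/and3P; set t := [seq _ | _ <- _] => /eqP nbt /eqP wt /eqP act.
have st : size t = 7 by rewrite size_map size_overlaps.
have [|||compl tE] := @complete_to_0_3
  (add_seq (add_seq (indicator X0) (indicator X1)) (indicator X2)) t.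
- by rewrite !size_add_seq ?size_indicator ?sX0 ?sX1 ?sX2.
- by [].
- move=> k k7; rewrite !nth_add_seq ?size_add_seq ?size_indicator ?sX0 ?sX1 ?sX2 //.
  rewrite !nth_indicator // -(nth_indicator st k7) nbt nth_overlaps //.
  have := overlaps_with_B DB (wD 0) (wD 1) k7; rewrite -/X0 -/X1 -/X2.
  by rewrite !inE; clear; lia.
have {}x0 : weight X0 = 2 := etrans x0 (wD 5).
have {}x1 : weight X1 = 2 := etrans x1 (wD 6).
have {}x2 : weight X2 = 2 := etrans x2 (wD 7).
have /allP/(_ _ (mem_masks sX0 x0))/allP/(_ _ (mem_masks sX1 x1)) := double_cover_autocorr.
move/allP/(_ _ (mem_masks sX2 x2)).
cbv beta zeta; rewrite compl -tE wt eqxx act => /eqP [e1 e2 e3].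
have ownD d : d \in [:: 1; 2; 3] ->
    autocorr (row_mask D (phi (phi b))) d + (autocorr X0 d + autocorr X1 d + autocorr X2 d) = 3.
  move=> d3; have := own_autocorr DB; rewrite vD => /(_ d erefl d3); rewrite sum_bases.
  rewrite (@autocorr_row_light D p d 0 (wD 0)) // (@autocorr_row_light D q d 0 (wD 1)) //.
  rewrite (@autocorr_row_light D b d 1 (wD 2)) // (@autocorr_row_light D (phi b) d 1 (wD 3)) //.
  by rewrite (autocorrsE a0 d3) (autocorrsE a1 d3) (autocorrsE a2 d3); lia.
have /allP/(_ _ (mem_masks (size_row_mask D (phi (phi b))) (wD 4))) := quad_autocorr_fano.
move/allP/(_ _ U_mask); rewrite (negbTE U_not_fano) implybF => /eqP; apply.
by apply: eq_seq3; rewrite -?e1 -?e2 -?e3; apply: ownD.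
Qed.

(** The 4-subset of [D] is a reflected progression with the step of [U], and a pair
    of [D] has that step as its difference, which then occurs too often in [D]. *)
Lemma no_222_411 D : D \in BB -> row_weights b c D <> [:: 0; 0; 2; 2; 2; 4; 1; 1].
Proof.
move=> DB vD; have wD i := congr1 (fun v => nth 0 v i) vD.
pose X0 := reflect_mask w0 (row_mask D c); pose X1 := reflect_mask w1 (row_mask D (phi c)).
pose X2 := reflect_mask w2 (row_mask D (phi (phi c))).
have [x0 a0 _] := reflect_maskE w0_lt (size_row_mask D c).
have [x1 a1 _] := reflect_maskE w1_lt (size_row_mask D (phi c)).
have [x2 a2 _] := reflect_maskE w2_lt (size_row_mask D (phi (phi c))).
rewrite -/X0 -/X1 -/X2 in x0 a0 x1 a1 x2 a2.
have [sX0 sX1 sX2] : [/\ size X0 = 7, size X1 = 7 & size X2 = 7] by rewrite !size_reflect_mask.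
have [|||compl X0E] := @complete_to_0_3
  (add_seq (add_seq (overlaps U (row_mask D b)) (indicator X1)) (indicator X2)) X0.
- by rewrite !size_add_seq ?size_indicator ?size_overlaps ?sX1 ?sX2.
- by [].
- move=> k k7; rewrite !nth_add_seq ?size_add_seq ?size_indicator ?size_overlaps ?sX1 ?sX2 //.
  rewrite !nth_indicator // nth_overlaps //.
  have := overlaps_with_B DB (wD 0) (wD 1) k7; rewrite -/X0 -/X1 -/X2.
  by rewrite !inE; clear; lia.
have /allP/(_ _ U_mask) := quad_of_progression; rewrite (negbTE U_not_fano) orFb.
have {}x0 : weight X0 = 4 := etrans x0 (wD 5).
have {}x1 : weight X1 = 1 := etrans x1 (wD 6).
have {}x2 : weight X2 = 1 := etrans x2 (wD 7).
move/allP/(_ _ (mem_masks (size_row_mask D b) (wD 2))).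
move/allP/(_ _ (mem_masks sX1 x1))/allP/(_ _ (mem_masks sX2 x2)).
cbv beta zeta; rewrite compl -X0E x0 a0 => /hasP[v].
have ownD d : d \in [:: 1; 2; 3] -> autocorr (row_mask D b) d + autocorr (row_mask D c) d <= 3.
  move=> d3; have := own_autocorr DB; rewrite vD => /(_ d erefl d3); rewrite sum_bases.
  by clear; lia.
rewrite -[add_seq _ _]/[:: autocorr (row_mask D b) 1 + autocorr (row_mask D c) 1;
   autocorr (row_mask D b) 2 + autocorr (row_mask D c) 2;
   autocorr (row_mask D b) 3 + autocorr (row_mask D c) 3].
by rewrite !inE => /or3P[] /eqP->; rewrite ltnNge ownD.
Qed.

Lemma triples_sum_shift Z X Y : size Z = 7 -> size X = 7 -> size Y = 7 ->
  weight Z = 2 -> weight X = 3 -> weight Y = 3 ->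
  (forall k, k < 7 -> overlap U (shift_mask k Z) + nth false X k + nth false Y k \in [:: 0; 3]) ->
  mask_sum X + ap_step U = mask_sum Y %[mod 7] \/ mask_sum X = mask_sum Y + ap_step U %[mod 7].
Proof.
move=> sZ sX sY wZ wX wY h.
have [|||compl YE] := @complete_to_0_3 (add_seq (overlaps U Z) (indicator X)) Y.
- by rewrite !size_add_seq ?size_indicator ?size_overlaps ?sX.
- by [].
- move=> k k7; rewrite !nth_add_seq ?size_indicator ?size_overlaps ?sX //.
  by rewrite nth_indicator // nth_overlaps // h.
have /allP/(_ _ U_mask) := triples_of_progression; rewrite (negbTE U_not_fano) orFb.
move/allP/(_ _ (mem_masks sZ wZ))/allP/(_ _ (mem_masks sX wX)).
cbv beta zeta; rewrite compl -YE wY => /orP[] /eqP; by [left | right].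
Qed.

(** Let s1 and s2 be the sums of residues of the two triples of [D].  In [phi @: D]
    they sit one row further and are doubled, and so on.  For each of the three
    images, [triples_sum_shift] compares the sums of the reflected triples, which
    are 3 w_i - s1 and 3 w_j - s2 up to this doubling, with (i,j) running through
    (1,2), (2,0), (0,1). *)
Lemma no_222_033 D : D \in BB -> row_weights b c D <> [:: 0; 0; 2; 2; 2; 0; 3; 3].
Proof.
move=> D0B vD0.
set D1 := phi @: D; set D2 := phi @: D1.
have D1B : D1 \in BB by apply: phi_aut.
have D2B : D2 \in BB by apply: phi_aut.
have vD1 : row_weights b c D1 = [:: 0; 0; 2; 2; 2; 3; 0; 3] by rewrite row_weights_phi vD0.
have vD2 : row_weights b c D2 = [:: 0; 0; 2; 2; 2; 3; 3; 0] by rewrite row_weights_phi vD1.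
have wD0 i := congr1 (fun v => nth 0 v i) vD0.
have wD1 i := congr1 (fun v => nth 0 v i) vD1.
have wD2 i := congr1 (fun v => nth 0 v i) vD2.
have refl0 w E x : w < 7 -> weight (row_mask E x) = 0 ->
    reflect_mask w (row_mask E x) = nseq 7 false.
  move=> w7 wE; have [wr _ _] := reflect_maskE w7 (size_row_mask E x).
  by apply: weight0; rewrite ?size_reflect_mask ?wr.
have z k : nth false (nseq 7 false) k = false by rewrite nth_nseq if_same.
pose F1 := row_mask D (phi c); pose F2 := row_mask D (phi (phi c)).
have m1F1 : row_mask D1 (phi (phi c)) = double_mask F1 by rewrite row_mask_phi.
have m1F2 : row_mask D1 c = double_mask F2 by rewrite -{1}[c]phi3 row_mask_phi.
have m2F1 : row_mask D2 c = double_mask (double_mask F1) by rewrite -{1}[c]phi3 row_mask_phi // m1F1.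
have m2F2 : row_mask D2 (phi c) = double_mask (double_mask F2) by rewrite row_mask_phi // m1F2.
have d1 := mask_sum_double (size_row_mask D (phi c)).
have d2 := mask_sum_double (size_row_mask D (phi (phi c))).
have dd1 := mask_sum_double (size_row_mask D1 (phi (phi c))).
have dd2 := mask_sum_double (size_row_mask D1 c).
have [x01 _ s01] := reflect_maskE w1_lt (size_row_mask D (phi c)).
have [x02 _ s02] := reflect_maskE w2_lt (size_row_mask D (phi (phi c))).
have [x11 _ s11] := reflect_maskE w2_lt (size_row_mask D1 (phi (phi c))).
have [x12 _ s12] := reflect_maskE w0_lt (size_row_mask D1 c).
have [x21 _ s21] := reflect_maskE w0_lt (size_row_mask D2 c).
have [x22 _ s22] := reflect_maskE w1_lt (size_row_mask D2 (phi c)).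
have g0 := @triples_sum_shift (row_mask D b) (reflect_mask w1 (row_mask D (phi c)))
  (reflect_mask w2 (row_mask D (phi (phi c)))).
have g1 := @triples_sum_shift (row_mask D1 b)
  (reflect_mask w2 (row_mask D1 (phi (phi c)))) (reflect_mask w0 (row_mask D1 c)).
have g2 := @triples_sum_shift (row_mask D2 b)
  (reflect_mask w0 (row_mask D2 c)) (reflect_mask w1 (row_mask D2 (phi c))).
have {}g0 : _ := g0 (size_row_mask _ _) (size_reflect_mask _ _) (size_reflect_mask _ _) (wD0 2)
  (etrans x01 (wD0 6)) (etrans x02 (wD0 7)).
have {}g1 : _ := g1 (size_row_mask _ _) (size_reflect_mask _ _) (size_reflect_mask _ _) (wD1 2)
  (etrans x11 (wD1 7)) (etrans x12 (wD1 5)).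
have {}g2 : _ := g2 (size_row_mask _ _) (size_reflect_mask _ _) (size_reflect_mask _ _) (wD2 2)
  (etrans x21 (wD2 5)) (etrans x22 (wD2 6)).
have wt_F1 : weight (row_mask D (phi c)) = 3 := wD0 6.
have wt_F2 : weight (row_mask D (phi (phi c))) = 3 := wD0 7.
have wt_11 : weight (row_mask D1 (phi (phi c))) = 3 := wD1 7.
have wt_12 : weight (row_mask D1 c) = 3 := wD1 5.
have wt_21 : weight (row_mask D2 c) = 3 := wD2 5.
have wt_22 : weight (row_mask D2 (phi c)) = 3 := wD2 6.
rewrite wt_F1 in s01; rewrite wt_F2 in s02; rewrite wt_11 in s11.
rewrite wt_12 in s12; rewrite wt_21 in s21; rewrite wt_22 in s22.
apply: (@signs_odd (mask_sum F1) (mask_sum F2) w0 w1 w2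
  (mask_sum (reflect_mask w1 F1)) (mask_sum (reflect_mask w2 F2))
  (mask_sum (reflect_mask w2 (row_mask D1 (phi (phi c)))))
  (mask_sum (reflect_mask w0 (row_mask D1 c)))
  (mask_sum (reflect_mask w0 (row_mask D2 c)))
  (mask_sum (reflect_mask w1 (row_mask D2 (phi c)))) (ap_step U) s01 s02).
- by move: s11 d1; rewrite m1F1 -/F1; clear; lia.
- by move: s12 d2; rewrite m1F2 -/F2; clear; lia.
- by move: s21 dd1 d1; rewrite m2F1 m1F1 -/F1; clear; lia.
- by move: s22 dd2 d2; rewrite m2F2 m1F2 -/F2; clear; lia.
- by rewrite /ap_step; case: ifP => // _; case: ifP.
- apply: g0 => k k7; have := overlaps_with_B D0B (wD0 0) (wD0 1) k7.
  by rewrite (refl0 w0 D c w0_lt (wD0 5)) z add0n addnA.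
- apply: g1 => k k7; have := overlaps_with_B D1B (wD1 0) (wD1 1) k7.
  rewrite (refl0 w1 D1 (phi c) w1_lt (wD1 6)) z add0n.
  by rewrite -addnA [X in _ + X]addnC.
- apply: g2 => k k7; have := overlaps_with_B D2B (wD2 0) (wD2 1) k7.
  by rewrite (refl0 w2 D2 (phi (phi c)) w2_lt (wD2 7)) z addn0 addnA.
Qed.

Lemma no_normal_00 D : D \in BB -> row_weights b c D \notin normal_types00.
Proof.
move=> DB; rewrite !inE; apply/negP=> /or4P[] /eqP.
- exact: no_033_222.
- exact: no_114_222.
- exact: no_222_033.
- exact: no_222_411.
Qed.

End Contradiction.

Lemma no_frobenius_action : False.
Proof.
have [b [c [bc [B BB' vB]]]] := exists_normal_33; have [D DB] := exists_normal_00 bc.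
exact/negP/(no_normal_00 bc BB' vB DB).
Qed.

End Frobenius.

End Design.

(** * The Frobenius group of order 21 *)

(** The translation by 1 and the multiplication by 2. *)
Lemma Frob21_generators : exists s h : {perm 'F_7},
  [/\ s \in Frob21, h \in Frob21, (s ^+ 7 = 1)%g, s != 1%g &
      (h ^+ 3 = 1)%g /\ (s * h = h * (s * s))%g].
Proof.
have U2 : (2%:R : 'F_7)%R \is a GRing.unit by [].
pose u : {unit 'F_7} := FinRing.unit 'F_7 U2.
have sE z : affine 1 1%R z = (z + 1)%R.
  by rewrite permE /affine_fun /= GRing.mul1r.
have hE z : affine u 0%R z = (2%:R * z)%R.
  by rewrite permE /affine_fun /= GRing.addr0.
exists (affine 1 1%R), (affine u 0%R); split.
- by apply/imsetP; exists (1%g, 1%R); rewrite // inE expg1n.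
- apply/imsetP; exists (u, 0%R); rewrite // inE.
  by apply/eqP; apply: val_inj; apply: val_inj.
- apply/permP=> z; rewrite permX perm1 /= !sE -!GRing.addrA.
  by rewrite -[RHS]GRing.addr0; congr (_ + _)%R; apply: val_inj.
- by apply/eqP=> /permP/(_ 0%R); rewrite sE perm1.
split; apply/permP=> z.
  rewrite permX perm1 /= !hE !GRing.mulrA -[RHS]GRing.mul1r.
  by congr (_ * _)%R; apply: val_inj.
rewrite !permM !sE !hE GRing.mulrDr -GRing.addrA; congr (_ + _)%R.
by apply: val_inj.
Qed.

Theorem theorem5p3 (T I : finType) (B : I -> {set T})
    (designB : is_design B 56 12 9) (qsB : quasi_symmetric B 0 3) :
  ~ admits_aut_group B Frob21_group.
Proof.
case: designB => cardT cardB pairB; case: qsB => _ meetB _ _ [H Haut isoH].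
(* Equal blocks at different indices would meet in 12 points. *)
have Binj : injective B.
  move=> i j Bij; apply/eqP; apply: contraT => ij.
  by have := meetB i j ij; rewrite Bij setIid cardB; case.
pose BB := [set B i | i : I].
have block_size C : C \in BB -> #|C| = 12 by case/imsetP=> i _ ->.
have pair_count x y : x != y -> #|[set C in BB | (x \in C) && (y \in C)]| = 9.
  move=> xy; rewrite -(pairB x y xy) -(card_imset _ Binj); apply: eq_card => C.
  rewrite inE; apply/andP/imsetP => [[/imsetP[i _ ->] xyi] | [i]].
    by exists i; rewrite // inE.
  by rewrite inE => xyi ->; rewrite imset_f.
have block_meet C D : C \in BB -> D \in BB -> C != D ->
    #|C :&: D| = 0 \/ #|C :&: D| = 3.
  by move=> /imsetP[i _ ->] /imsetP[j _ ->] ij; apply: meetB; apply: contraNneq ij => ->.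
have aut g C : g \in H -> C \in BB -> g @: C \in BB.
  by move=> /(subsetP Haut)/design_autP[s gs] /imsetP[i _ ->]; rewrite gs imset_f.
rewrite isog_sym in isoH; have /isogP[f f_inj fH] := isoH.
have [s [h [sF hF s7 s1 [h3 sh_rel]]]] := Frob21_generators.
have inH x : x \in Frob21 -> f x \in H by move=> xF; rewrite -fH mem_morphim.
pose sigma := f s; pose phi := f h.
have sigma7 : (sigma ^+ 7 = 1)%g by rewrite -morphX // s7 morph1.
have sigma1 : sigma != 1%g by rewrite (morph_injm_eq1 f_inj).
have phi3 : (phi ^+ 3 = 1)%g by rewrite -morphX // h3 morph1.
have phi_sigma x : phi (sigma x) = sigma (sigma (phi x)).
  have : (sigma * phi = phi * (sigma * sigma))%g by rewrite -!morphM ?groupM // sh_rel.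
  by move/permP/(_ x); rewrite !permM.
have sigma_free x : sigma x != x.
  have := order7_fixed_points cardT block_size pair_count block_meet
            (fun C => aut _ C (inH _ sF)) sigma7 sigma1.
  by move/setP/(_ x); rewrite !inE => ->.
have F8 := card_fixed_points_le8 cardT sigma7 sigma_free phi_sigma.
have F2 := order3_fixed_points cardT block_size pair_count block_meet
  (fun C => aut _ C (inH _ hF)) phi3 F8.
have [p [q [pq F]]] := cards2P _ (introT eqP F2).
have fixF x : (phi x == x) = (x \in [set p; q]) by rewrite -F inE.
apply: (no_frobenius_action cardT block_size pair_count block_meet sigma7 sigma_free
  _ phi_sigma _ _ pq _ (fun C => aut _ C (inH _ sF)) (fun C => aut _ C (inH _ hF))).
- by move=> x; rewrite -[LHS]/(iter 3 phi x) -permX phi3 perm1.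
- by apply/eqP; rewrite fixF !inE eqxx.
- by apply/eqP; rewrite fixF !inE eqxx orbT.
- by move=> x /eqP; rewrite fixF !inE => /orP[] /eqP; [left | right].
Qed.
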